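(* Let $(g_j)_j\subset L^{p'}(\Omega)$ be a minimizing sequence of controls for the nonlocal optimal control problem $(\mathcal P^\delta)$, with corresponding states $(u_j)_j\subset u_0+X_0$ (so $(g_j,u_j)\in\mathcal A^\delta$ and $I_\delta(g_j,u_j)\to\inf_{\mathcal A^\delta} I_\delta$), and assume there is $C>0$ with $\int_\Omega |g_j|^{p'}dx<C$ for all $j$. Suppose (after passing to a subsequence) that $g_j\rightharpoonup g$ weakly in $L^{p'}(\Omega)$ and $u_j\to u^*$ strongly in $L^p$, with $u^*\in u_0+X_0$. Let $u$ be the state associated to $g$. Then $$\lim_{j\to\infty}\min_{w\in u_0+X_0}\left\{\frac1p B_h(w,w)-\int_\Omega g_j(x)w(x)\,dx\right\}=\min_{w\in u_0+X_0}\left\{\frac1p B_h(w,w)-\int_\Omega g(x)w(x)\,dx\right\}$$ and $u=u^*$.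
   Context: Let $\Omega\subset\mathbb R^N$ be a bounded open domain, $\delta>0$ fixed, $\Omega_\delta=\Omega\cup\bigcup_{q\in\partial\Omega}B(q,\delta)$, $p>1$, $p'=p/(p-1)$, $s\in(0,1)$ with $N>ps$. Kernel: $k_\delta\ge 0$ is radial with $\operatorname{supp}k_\delta\subset B(0,\delta)$, $\frac1{C_N}\int_{B(0,\delta)}k_\delta(|z|)\,dz=1$, where $C_N=\frac{1}{\operatorname{meas}(S^{N-1})}\int_{S^{N-1}}|\omega\cdot e|^p\,d\sigma^{N-1}(\omega)$ ($e$ any unit vector), and $k_\delta(|z|)\ge \frac{c_0}{|z|^{N+(s-1)p}}$ for $0<|z|<\delta$, with a constant $c_0>0$. Coefficients: given $0<h_{\min}<h_{\max}$, $\mathcal H$ is the set of measurable $h:\Omega_\delta\to\mathbb R$ with $h(x)\in[h_{\min},h_{\max}]$ for a.e. $x\in\Omega$ and $h=0$ in $\Omega_\delta\setminus\Omega$. Fix $h\in\mathcal H$. For $\eta\in\mathcal H$, $$B_\eta(u,w)=\int_{\Omega_\delta}\int_{\Omega_\delta}\tfrac{\eta(x')+\eta(x)}2\,k_\delta(|x'-x|)\frac{|u(x')-u(x)|^{p-2}(u(x')-u(x))}{|x'-x|^p}(w(x')-w(x))\,dx'dx,$$ and $B$ denotes the same expression with the factor $\tfrac{\eta(x')+\eta(x)}2$ replaced by $1$. Spaces: $X=\{u\in L^p(\Omega_\delta):B(u,u)<\infty\}$, $X_0=\{u\in X:u=0\text{ in }\Omega_\delta\setminus\Omega\}$. The boundary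 datum $u_0$ is in $\{w|_{\Omega_\delta\setminus\Omega}:w\in X\}$ and is identified with an element of $X$ extending it, still denoted $u_0$; $u_0+X_0=\{u_0+w:w\in X_0\}$. State: for $g\in L^{p'}(\Omega)$, the state associated to $g$ is the unique $u\in u_0+X_0$ such that $B_h(u,w)=\int_\Omega g\,w\,dx$ for all $w\in X_0$. $\mathcal A^\delta$ is the set of pairs $(g,u)\in L^{p'}(\Omega)\times X$ with $u$ the state associated to $g$. Problem $(\mathcal P^\delta)$: minimize over $\mathcal A^\delta$ the cost $$I_\delta(g,u)=\int_\Omega\left(G(x,u(x))+\beta|g(x)|^{p'}\right)dx+\gamma B_{h_0}(u,u),$$ where $\beta,\gamma>0$ and $h_0\in\mathcal H$ are given and $G:\Omega\times\mathbb R\to\mathbb R$ is a measurable positive function for which there is $L>0$ with $|G(x,a)-G(x,b)|\le L|a-b|$ for all $x\in\Omega$, $a,b\in\mathbb R$. *)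

(* Defs.v *)
(* R^N is 'rV[R]_N over an arbitrary realType R. *)
From HB Require Import structures.
From mathcomp Require Import all_boot all_order all_algebra.
From mathcomp Require Import all_classical all_reals all_analysis measurable_realfun.

Set Implicit Arguments.
Unset Strict Implicit.
Unset Printing Implicit Defensive.
Import Order.TTheory GRing.Theory Num.Def Num.Theory.
Import numFieldNormedType.Exports.
Local Open Scope classical_set_scope.
Local Open Scope ring_scope.

(* The sigma-algebra on 'rV[R]_n generated by the coordinates, i.e. the Borel
   sets of R^n; this mirrors the library's instance for n.-tuple T. *)
Definition measure_rV_display : measure_display. Proof. exact. Qed.

Section measurable_rV.
Context {R : realType} {n : nat}.
Let coors : 'I_n -> 'rV[R]_n -> R := fun i x => x ord0 i.

Let rV_set0 : g_sigma_preimage coors set0.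
Proof. exact: sigma_algebra0. Qed.

Let rV_setC A : g_sigma_preimage coors A -> g_sigma_preimage coors (~` A).
Proof. exact: sigma_algebraC. Qed.

Let rV_bigcup (F : _^nat) : (forall i, g_sigma_preimage coors (F i)) ->
  g_sigma_preimage coors (\bigcup_i (F i)).
Proof. exact: sigma_algebra_bigcup. Qed.

HB.instance Definition _ := @isMeasurable.Build measure_rV_display
  'rV[R]_n (g_sigma_preimage coors) rV_set0 rV_setC rV_bigcup.

End measurable_rV.

Lemma measurable_coord (R : realType) n (i : 'I_n) :
  measurable_fun [set: 'rV[R]_n] (fun x : 'rV[R]_n => x ord0 i).
Proof.
move=> _ Y mY; rewrite setTI; apply: sub_sigma_algebra => /=.
rewrite -bigcup_seq/=; exists i => /=; first by rewrite mem_index_enum.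
by exists Y => //; rewrite setTI.
Qed.

Lemma measurable_fun_rVP d (T : measurableType d) (R : realType) n
    (f : T -> 'rV[R]_n) :
  measurable_fun [set: T] f <->
  forall i, measurable_fun [set: T] (fun x => f x ord0 i).
Proof.
split=> [mf i|mf].
  by apply: (measurableT_comp (measurable_coord i)).
have sub : g_sigma_preimage (fun i (x : T) => f x ord0 i) `<=` measurable.
  apply: smallest_sub; first exact: sigma_algebra_measurable.
  case: n => [|n] in f mf *; first by rewrite big_ord0.
  rewrite -bigcup_mkord_ord; apply: bigcup_sub => i Ii.
  by move=> A [B mB <-]; exact: mf.
move=> _ A mA; apply: sub.
by rewrite (g_sigma_preimage_comp (fun i (x : 'rV[R]_n) => x ord0 i) f); exists A.
Qed.

Section lebesgueN.
Context {R : realType}.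
Local Open Scope ereal_scope.

Section step.
Context {n : nat} (m : {sigma_finite_measure set 'rV[R]_n -> \bar R}).

Definition consrV (x : measurableTypeR R * 'rV[R]_n) : 'rV[R]_n.+1 :=
  row_mx (x.1)%:M x.2 : 'rV[R]_(1 + n).

Lemma measurable_consrV : measurable_fun [set: measurableTypeR R * 'rV[R]_n] consrV.
Proof.
apply/measurable_fun_rVP => i.
have -> : (fun x => consrV x ord0 i) =
    (if fintype.split (i : 'I_(1 + n)) is inr j then (fun y : 'rV[R]_n => y ord0 j) \o snd
     else fst).
  apply/funext => x; rewrite /consrV mxE; case: fintype.split => // j.
  by rewrite mxE (ord1 j) eqxx mulr1n.
case: fintype.split => // j.
exact: (measurableT_comp (measurable_coord j) measurable_snd).
Qed.

Definition lebesgueS : set 'rV[R]_n.+1 -> \bar R :=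
  pushforward (@lebesgue_measure R \x m) consrV.

Let lebesgueS_measure : {measure set 'rV[R]_n.+1 -> \bar R} :=
  measure_function_pushforward__canonical__measure_function_Measure
    (@lebesgue_measure R \x m) measurable_consrV.

HB.instance Definition _ := isMeasure.Build _ _ _ lebesgueS
  (measure0 lebesgueS_measure) (measure_ge0 lebesgueS_measure)
  (@measure_semi_sigma_additive _ _ _ lebesgueS_measure).

Let lebesgueS_sigma_finite : sigma_finite [set: 'rV[R]_n.+1] lebesgueS.
Proof.
have /sigma_finiteP[F [FT ndF Ffin]] := sigma_finiteT (@lebesgue_measure R).
have /sigma_finiteP[G [GT ndG Gfin]] := sigma_finiteT m.
pose uncons (y : 'rV[R]_n.+1) : measurableTypeR R * 'rV[R]_n :=
  (y ord0 ord0, \row_j y ord0 (lift ord0 j)).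
have unconsK : cancel consrV uncons.
  move=> [x y]; congr pair.
    by rewrite /consrV mxE; case: splitP => // k _; rewrite mxE (ord1 k) eqxx mulr1n.
  apply/rowP => k; rewrite mxE /consrV (_ : lift ord0 k = rshift 1 k).
    by rewrite (@row_mxEr _ 1 1 n).
  exact: val_inj.
have muncons : measurable_fun [set: 'rV[R]_n.+1] uncons.
  apply/measurable_fun_pairP; split => /=; first exact: measurable_coord.
  apply/measurable_fun_rVP => k.
  rewrite (_ : (fun x => _) = (fun y : 'rV[R]_n.+1 => y ord0 (lift ord0 k))).
    exact: measurable_coord.
  by apply/funext => y; rewrite /= mxE.
exists (fun i => uncons @^-1` (F i `*` G i)).
  apply/esym; rewrite -preimage_bigcup -subTset => y _ /=.
  have [k _ Fk] : (\bigcup_i F i) (uncons y).1 by rewrite -FT.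
  have [l _ Gl] : (\bigcup_i G i) (uncons y).2 by rewrite -GT.
  exists (maxn k l) => //; split.
    by move: Fk; exact/subsetPset/ndF/leq_maxl.
  by move: Gl; exact/subsetPset/ndG/leq_maxr.
move=> i; have [mF Foo] := Ffin i; have [mG Goo] := Gfin i; split.
  by rewrite -[X in measurable X]setTI; apply: muncons => //; exact: measurableX.
rewrite /lebesgueS /pushforward -comp_preimage.
have -> : uncons \o consrV = id by exact/funext/unconsK.
by rewrite preimage_id product_measure1E// lte_mul_pinfty// ge0_fin_numE.
Qed.

HB.instance Definition _ := Measure_isSigmaFinite.Build _ _ _ lebesgueS
  lebesgueS_sigma_finite.

End step.

(* n-dimensional Lebesgue measure on the Borel sets of R^n. *)
Fixpoint lebesgueN n : {sigma_finite_measure set 'rV[R]_n -> \bar R} :=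
  if n is n'.+1 then @lebesgueS n' (lebesgueN n') else \d_(0%R : 'rV[R]_0).

End lebesgueN.

Section euclidean.
Context {R : realType} {N : nat}.

Definition edot (x y : 'rV[R]_N) : R := \sum_(i < N) x ord0 i * y ord0 i.

(* The Euclidean norm; the library's norm on 'rV[R]_N is the sup norm. *)
Definition enorm (x : 'rV[R]_N) : R := Num.sqrt (edot x x).

Definition eball (x : 'rV[R]_N) (r : R) : set 'rV[R]_N :=
  [set y | enorm (y - x) < r].

Definition esphere : set 'rV[R]_N := [set x | enorm x = 1].

Lemma measurable_enorm : measurable_fun [set: 'rV[R]_N] enorm.
Proof.
have msqrt : measurable_fun [set: R] (@Num.sqrt R).
  by apply: continuous_measurable_fun => x; exact: sqrt_continuous.
apply: (measurableT_comp msqrt).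
by apply: measurable_sum => i; apply: measurable_funM; exact: measurable_coord.
Qed.

Lemma measurable_eball0 r : measurable (eball 0 r).
Proof.
rewrite (_ : eball 0 r = enorm @^-1` `]-oo, r[).
  by rewrite -[X in measurable X]setTI; apply: measurable_enorm.
by apply/seteqP; split => x; rewrite /eball/= subr0 in_itv.
Qed.

Definition radial_proj (x : 'rV[R]_N) : 'rV[R]_N := (enorm x)^-1 *: x.

Lemma measurable_radial_proj : measurable_fun [set: 'rV[R]_N] radial_proj.
Proof.
apply/measurable_fun_rVP => i.
have minv : measurable_fun [set: 'rV[R]_N] (fun x => (enorm x)^-1).
  rewrite (_ : (fun x => _) = (@powR R ^~ (-1)) \o enorm).
    exact: (measurableT_comp (measurable_powR (-1)) measurable_enorm).
  by apply/funext => x; rewrite /= powR_inv1// sqrtr_ge0.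
rewrite (_ : (fun x => _) = (fun x => (enorm x)^-1 * x ord0 i)).
  by apply: measurable_funM => //; exact: measurable_coord.
by apply/funext => x; rewrite mxE.
Qed.

(* Surface measure on the unit sphere, defined from Lebesgue measure by
   sigma(A) = N * |{r w : w in A, 0 < r < 1}|, i.e. so that integration in
   polar coordinates holds; it is carried by esphere when 0 < N. *)
Definition sphere_measure : set 'rV[R]_N -> \bar R :=
  pushforward
    (mscale (N%:R : R)%:nng (mrestr (lebesgueN N) (measurable_eball0 1)))
    radial_proj.

Let sphere_measure_measure : {measure set 'rV[R]_N -> \bar R} :=
  measure_function_pushforward__canonical__measure_function_Measure
    (mscale (N%:R : R)%:nng (mrestr (lebesgueN N) (measurable_eball0 1)))
    measurable_radial_proj.

HB.instance Definition _ := isMeasure.Build _ _ _ sphere_measure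
  (measure0 sphere_measure_measure) (measure_ge0 sphere_measure_measure)
  (@measure_semi_sigma_additive _ _ _ sphere_measure_measure).

(* C_N is sphere_mean p e for any unit vector e. *)
Definition sphere_mean (p : R) (e : 'rV[R]_N) : R :=
  (fine (sphere_measure esphere))^-1 *
  \int[sphere_measure]_(w in esphere) (`|edot w e| `^ p).

Definition boundary (A : set 'rV[R]_N) : set 'rV[R]_N := closure A `\` A°.

Definition enlarge (A : set 'rV[R]_N) (delta : R) : set 'rV[R]_N :=
  A `|` \bigcup_(q in boundary A) eball q delta.

End euclidean.

(* Functions are representatives defined on all of R^N, of which only the
   values on the relevant set D matter; equality is equality a.e. on D. *)
Section nonlocal.
Context {R : realType} {N : nat}.
Local Notation V := 'rV[R]_N.
Local Notation mu := (@lebesgueN R N).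

Definition Lp (D : set V) (p : R) : set (V -> R) :=
  [set f | f \_ D \in Lfun mu p%:E].

(* The dual of L^p is identified with L^(p/(p-1)); meant for 1 < p. *)
Definition weak_cvg_Lp (D : set V) (p : R) (f_ : nat -> V -> R) (f : V -> R) :=
  forall phi, Lp D (p / (p - 1)) phi ->
    (\int[mu]_(x in D) (f_ j x * phi x)%:E @[j --> \oo]
      --> \int[mu]_(x in D) (f x * phi x)%:E)%E.

Definition strong_cvg_Lp (D : set V) (p : R) (f_ : nat -> V -> R) (f : V -> R) :=
  ('N[mu]_p%:E[EFin \o ((f_ j \- f)%R \_ D)] @[j --> \oo] --> 0)%E.

Definition is_minimum (T : Type) (A : set T) (F : T -> \bar R) (m : \bar R) :=
  (exists2 w, A w & F w = m) /\ (forall w, A w -> (m <= F w)%E).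

Section problem.
Variables (Omega : set V) (delta p : R) (k : R -> R).
Local Notation Omegad := (enlarge Omega delta).
Local Notation p' := (p / (p - 1)).

Definition coefficient (hmin hmax : R) (h : V -> R) : Prop :=
  [/\ measurable_fun Omegad h,
      {ae mu, forall x, Omega x -> hmin <= h x <= hmax} &
      {ae mu, forall x, (Omegad `\` Omega) x -> h x = 0}].

(* `|0| `^ (p - 2) * 0 = 0 whatever p, and the integrand vanishes at x' = x. *)
Definition nonlocal_form (c : V -> V -> R) (u w : V -> R) : \bar R :=
  (\int[mu]_(x in Omegad) \int[mu]_(x' in Omegad)
    (c x' x * k (enorm (x' - x)) *
     (`|u x' - u x| `^ (p - 2) * (u x' - u x) / enorm (x' - x) `^ p) *
     (w x' - w x))%R%:E)%E.

Definition formB : (V -> R) -> (V -> R) -> \bar R :=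
  nonlocal_form (fun _ _ => 1).

Definition formBh (h : V -> R) : (V -> R) -> (V -> R) -> \bar R :=
  nonlocal_form (fun x' x => (h x' + h x) / 2).

Definition spaceX : set (V -> R) :=
  [set u | Lp Omegad p u /\ (formB u u < +oo)%E].

Definition spaceX0 : set (V -> R) :=
  [set u | spaceX u /\ {ae mu, forall x, (Omegad `\` Omega) x -> u x = 0}].

Definition affineX0 (u0 : V -> R) : set (V -> R) :=
  [set u0 \+ w | w in spaceX0].

Variables (u0 h : V -> R).

(* Uniqueness of the state is a theorem and is not part of the definition. *)
Definition is_state (g u : V -> R) : Prop :=
  affineX0 u0 u /\
  forall w, spaceX0 w ->
    formBh h u w = (\int[mu]_(x in Omega) (g x * w x)%:E)%E.

Definition admissible_pairs : set ((V -> R) * (V -> R)) :=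
  [set gu | [/\ Lp Omega p' gu.1, spaceX gu.2 & is_state gu.1 gu.2]].

Definition cost (G : V -> R -> R) (beta gamma : R) (h0 : V -> R)
    (gu : (V -> R) * (V -> R)) : \bar R :=
  (\int[mu]_(x in Omega) (G x (gu.2 x) + beta * `|gu.1 x| `^ p')%R%:E
   + gamma%:E * formBh h0 gu.2 gu.2)%E.

Definition energy (g w : V -> R) : \bar R :=
  (p^-1%:E * formBh h w w - \int[mu]_(x in Omega) (g x * w x)%:E)%E.

End problem.
End nonlocal.

(* Main.v *)
Require Import Defs.
From mathcomp Require Import all_boot all_order all_algebra.
From mathcomp Require Import all_classical all_reals all_analysis.
From mathcomp Require Import measurable_realfun ring lra.
Set Implicit Arguments.
Unset Strict Implicit.
Unset Printing Implicit Defensive.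
Import Order.TTheory GRing.Theory Num.Def Num.Theory.
Import numFieldNormedType.Exports.
Local Open Scope classical_set_scope.
Local Open Scope ring_scope.

(** The state associated to [g] is the critical point of the convex energy
    [J_g w = B_h (w, w) / p - \int g w], so everything rests on measuring how far
    a competitor [v] is from the state [u] by the energy gap. Because the state
    equation cancels the first-order terms, [J_g v - J_g u] is exactly the
    integral, against the kernel, of the Bregman divergence of [`|.| ^ p / p]
    between the increments of [u] and of [v] ([energyR_state]). This divergence
    is nonnegative, which makes states minimizers ([state_minimizes]), and it
    vanishes only when its two arguments are equal ([bregman_eq0]).

    Convergence of the minima. Comparing the minimizer [u_j] of [J_(g_j)] with
    the competitor [u] gives
      [0 <= J_g u_j - J_g u <= \int (g_j - g) (u_j - u)],
    and the right-hand side tends to [0] as a product of a weakly and a strongly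
    convergent sequence ([pairing_weak_strong]). The energies [J_g u_j] therefore
    tend to [J_g u], and so do the minima [J_(g_j) u_j], which differ from them by
    [\int (g_j - g) u_j] ([energyR_cvg]).

    Identification of the limit. The gap between [u] and [u_j] tends to [0]. Along
    a subsequence [u_j] tends to [ustar] almost everywhere, so the Bregman
    divergence between the increments of [u] and [ustar] vanishes wherever the
    kernel is positive ([Rintegral_bregman_cvg0]). Hence [u - ustar] is almost
    everywhere constant on the [delta]-ball around almost every point of [Omega]
    ([increment_ae_eq]); such a ball lies in the enlarged domain
    ([eball_sub_enlarge]). As [u - ustar] vanishes outside the bounded set
    [Omega], its nullity propagates inwards by slabs of thickness [delta / 2]
    until it covers [Omega] ([locally_constant_ae0]). *)

(** * Convexity of the power function *)

Section power.
Context {R : realType} (p : R).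
Hypothesis p1 : 1 < p.

Definition dpow (a : R) : R := `|a| `^ (p - 2) * a.

(** The Bregman divergence of the convex function [x |-> `|x| ^ p / p], whose
    derivative is [dpow]. *)
Definition bregman (a b : R) : R :=
  p^-1 * `|b| `^ p - p^-1 * `|a| `^ p - dpow a * (b - a).

Let p0 : 0 < p. Proof. exact: lt_trans p1. Qed.
Let p_neq0 : p != 0. Proof. by rewrite gt_eqF. Qed.
Let pB1_neq0 : p - 1 != 0. Proof. by rewrite gt_eqF// subr_gt0. Qed.

(** Writing [x = e ^ xi], [y = e ^ eta] and dividing by the left-hand side, this
    is the weighted sum of the two strict tangent inequalities of the exponential
    at [-l] and [(p - 1) * l], where [l = eta - xi]; their linear terms cancel. *)
Lemma young_powR_lt (x y : R) : 0 <= x -> 0 <= y -> x != y ->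
  x `^ (p - 1) * y < (1 - p^-1) * x `^ p + p^-1 * y `^ p.
Proof.
have q0 : 0 < 1 - p^-1 by rewrite subr_gt0 invf_lt1.
have pi0 : 0 < p^-1 by rewrite invr_gt0.
rewrite !le_eqVlt => /predU1P[<-|x0] /predU1P[<-|y0]; first by rewrite eqxx.
- by move=> _; rewrite !powR0// mul0r mulr0 add0r mulr_gt0// powR_gt0.
- by move=> _; rewrite !powR0// !mulr0 addr0 mulr_gt0// powR_gt0.
move=> xy; rewrite /powR !gt_eqF//.
set xi := ln x; set eta := ln y.
pose l := eta - xi.
have l0 : l != 0.
  by rewrite subr_eq0; apply: contra xy => /eqP/ln_inj ->//; rewrite posrE.
rewrite -[in X in X < _](lnK (_ : y \is Num.pos)) ?posrE// -/eta -expRD.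
set T := _ + eta.
have -> : p * xi = T + - l by rewrite /T /l; ring.
have -> : p * eta = T + (p - 1) * l by rewrite /T /l; ring.
clearbody T; rewrite !expRD ![_ * (expR T * _)]mulrCA -mulrDr -[ltLHS]mulr1.
rewrite ltr_pM2l ?expR_gt0//.
have e1 : 1 - l < expR (- l) by rewrite expR_gt1Dx ?oppr_eq0.
have e2 : 1 + (p - 1) * l < expR ((p - 1) * l) by rewrite expR_gt1Dx// mulf_neq0.
have := ltrD (_ : (1 - p^-1) * (1 - l) < (1 - p^-1) * expR (- l))
             (_ : p^-1 * (1 + (p - 1) * l) < p^-1 * expR ((p - 1) * l)).
rewrite !ltr_pM2l// => /(_ e1 e2); apply: le_lt_trans.
by rewrite le_eqVlt; apply/orP; left; apply/eqP; field.
Qed.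

Lemma young_powR (x y : R) : 0 <= x -> 0 <= y ->
  x `^ (p - 1) * y <= (1 - p^-1) * x `^ p + p^-1 * y `^ p.
Proof.
move=> x0 y0; have [->|xy] := eqVneq x y; last exact/ltW/young_powR_lt.
by rewrite [leLHS]mulrC mulr_powRB1// -mulrDl subrK mul1r.
Qed.

Lemma dpow_norm (a : R) : `|dpow a| = `|a| `^ (p - 1).
Proof.
rewrite /dpow normrM [`| _ `^ _|]ger0_norm ?powR_ge0//.
have [->|a0] := eqVneq a 0; first by rewrite normr0 mulr0 powR0.
rewrite -[X in _ * X = _]powRr1// -powRD; last by rewrite normr_eq0 a0 implybT.
by congr (_ `^ _); ring.
Qed.

Lemma dpow_mul (a : R) : dpow a * a = `|a| `^ p.
Proof.
have [->|a0] := eqVneq a 0; first by rewrite normr0 powR0// mulr0.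
rewrite /dpow -mulrA -expr2 -real_normK ?num_real// -powR_mulrn// -powRD; last first.
  by rewrite normr_eq0 a0 implybT.
by congr (_ `^ _); ring.
Qed.

Lemma bregmanE (a b : R) :
  bregman a b = p^-1 * `|b| `^ p + (1 - p^-1) * `|a| `^ p - dpow a * b.
Proof. by rewrite /bregman mulrBr dpow_mul; ring. Qed.

Lemma bregman_ge0 (a b : R) : 0 <= bregman a b.
Proof.
rewrite bregmanE subr_ge0 (le_trans (ler_norm _))// normrM dpow_norm.
by rewrite [leRHS]addrC young_powR.
Qed.

(** Strict convexity: equality in Young's inequality forces [`|a| = `|b|], and
    then equality in [dpow a * b <= `|dpow a * b|] fixes the sign. *)
Lemma bregman_eq0 (a b : R) : bregman a b = 0 -> a = b.
Proof.
move=> /eqP; rewrite bregmanE subr_eq0 => /eqP E.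
have ab : `|a| = `|b|.
  apply/eqP/negPn/negP => /(young_powR_lt (normr_ge0 _) (normr_ge0 _)).
  by rewrite ltNge [leLHS]addrC E -dpow_norm -normrM real_ler_norm// num_real.
have [a0|a0] := eqVneq a 0.
  by move: ab; rewrite a0 normr0 => /esym/normr0_eq0 ->.
move: E; rewrite -ab -mulrDl subrKC mul1r -dpow_mul => /mulfI; apply.
by rewrite -normr_eq0 dpow_norm powR_eq0 normr_eq0 negb_and a0.
Qed.

(** The tangent inequality [0 <= bregman c d], used in both directions, gives
    [`| `|a| ^ p - `|b| ^ p | <= p * (max `|a| `|b|) ^ (p - 1) * `|a - b|]. *)
Lemma normr_powR_continuous : continuous (fun b : R => `|b| `^ p).
Proof.
move=> a.
(* A Lipschitz constant on the unit ball around a. *)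
pose K := p * (`|a| + 1) `^ (p - 1).
have K0 : 0 < K by rewrite mulr_gt0// powR_gt0// ltr_wpDl.
apply/cvgrPdist_le => eps eps0.
near=> b.
have ab1 : `|a - b| <= 1.
  by near: b; apply: (cvgr_dist_le _); rewrite //; exact: cvg_id.
have abe : `|a - b| <= eps / K.
  by near: b; apply: (cvgr_dist_le _); rewrite ?divr_gt0//; exact: cvg_id.
have key (c d : R) : `|c| <= `|a| + 1 -> `|c - d| = `|a - b| ->
    `|c| `^ p - `|d| `^ p <= eps.
  move=> ca cd; have := bregman_ge0 c d; rewrite /bregman => B.
  have : `|c| `^ p - `|d| `^ p <= p * (dpow c * (c - d)).
    rewrite -(ler_pM2l (_ : 0 < p^-1)) ?invr_gt0// mulrBr mulKf//.
    rewrite -subr_ge0 (le_trans B)// le_eqVlt; apply/orP; left; apply/eqP.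
    by ring.
  move=> /le_trans; apply; rewrite (le_trans (ler_norm _))//.
  rewrite normrM [`|dpow _ * _|]normrM cd dpow_norm.
  rewrite (ger0_norm (ltW p0)) mulrA (@le_trans _ _ (K * `|a - b|))//.
    rewrite ler_wpM2r// ler_wpM2l ?(ltW p0)//.
    have pm0 : 0 <= p - 1 by rewrite subr_ge0 ltW.
    by apply: ge0_ler_powR => //; rewrite nnegrE ?addr_ge0.
  by rewrite mulrC -ler_pdivlMr.
rewrite ler_norml; apply/andP; split; last by apply: key => //; rewrite lerDl.
rewrite -opprB lerN2; apply: key; last by rewrite distrC.
by rewrite -[b](subrKC a) (le_trans (ler_normD _ _))// lerD2l distrC.
Unshelve. all: by end_near. Qed.

Lemma dpow_mul_le (a b : R) : `|dpow a * b| <= `|a| `^ p + `|b| `^ p.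
Proof.
rewrite normrM dpow_norm (le_trans (young_powR _ _))// lerD// ler_piMl ?powR_ge0//.
  by rewrite gerBl invr_ge0 ltW.
by rewrite invf_le1// ltW.
Qed.

Lemma normB_powR_le (a b : R) :
  `|a - b| `^ p <= 2 `^ p * (`|a| `^ p + `|b| `^ p).
Proof.
have mono := ge0_ler_powR (ltW p0).
pose m := Num.max `|a| `|b|.
have m0 : 0 <= m by rewrite le_max normr_ge0.
rewrite (@le_trans _ _ ((2 * m) `^ p))//.
  rewrite mono ?nnegrE ?mulr_ge0// (le_trans (ler_normB _ _))// mulr_natl mulr2n.
  by rewrite lerD// le_max lexx ?orbT.
rewrite powRM// ler_wpM2l ?powR_ge0// /m.
have [_|_] := leP `|a| `|b|; [rewrite lerDr|rewrite lerDl]; exact: powR_ge0.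
Qed.

End power.

(** * Cubes and open sets of R^N *)

Section cubes.
Context {R : realType}.

Definition cube {N} (x : 'rV[R]_N) (r : R) : set 'rV[R]_N :=
  [set y | forall i, `|x ord0 i - y ord0 i| < r].

Lemma ball_cube N (x : 'rV[R]_N) r : 0 < r -> ball x r = cube x r.
Proof.
move=> r0; apply/seteqP; split=> [y [_ xy] i|y xy]; first exact: xy.
by split=> // i j; rewrite (ord1 i); exact: xy.
Qed.

Lemma measurable_cube N (x : 'rV[R]_N) r : measurable (cube x r).
Proof.
rewrite (_ : cube x r =
    \bigcap_(i in [set: 'I_N]) ((fun y : 'rV_N => y ord0 i) @^-1` ball (x ord0 i) r)).
  apply: fin_bigcap_measurable => // i _.
  rewrite -[X in measurable X]setTI; apply: measurable_coord => //.
  exact: measurable_ball.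
by apply/seteqP; split=> [y xy i _|y xy i]; [exact: xy|exact: (xy i I)].
Qed.

(** Cubes are measurable because the sigma-algebra is generated by the
    coordinates, and an open set is the union of the countably many cubes with
    rational centre and radius [1 / n.+1] that it contains. *)
Lemma open_measurable_rV N (O : set 'rV[R]_N) : open O -> measurable O.
Proof.
move=> oO; pose cen (q : 'rV[rat]_N) : 'rV[R]_N := map_mx (@ratr R) q.
pose Q := [set c : 'rV[rat]_N * nat | cube (cen c.1) c.2.+1%:R^-1 `<=` O].
rewrite (_ : O = \bigcup_c (if c \in Q then cube (cen c.1) c.2.+1%:R^-1 else set0)).
  apply: countable_bigcupT_measurable => // c.
  by case: ifPn => _ //; exact: measurable_cube.
apply/seteqP; split=> [x Ox|x [c _]]; last by case: ifPn => // /[!inE] Qc /Qc.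
have [e /= e0 xeO] : exists2 e, 0 < e & cube x e `<=` O.
  have /nbhs_ballP[e /= e0] := oO _ Ox.
  by rewrite ball_cube//; exists e.
pose n := Num.truncn (2 / e).
have ne : n.+1%:R^-1 < e / 2.
  by rewrite -[ltRHS]invf_div ltf_pV2 ?posrE ?divr_gt0// truncnS_gt.
have qP i : exists q : rat,
    ratr q \in `](x ord0 i - n.+1%:R^-1), (x ord0 i + n.+1%:R^-1)[%R.
  by apply: rat_in_itvoo; rewrite ltrD2l gtrN// invr_gt0.
pose q := \row_i sval (cid (qP i)).
have qx i : `|cen q ord0 i - x ord0 i| < n.+1%:R^-1.
  by rewrite !mxE; case: (cid _) => /= t; rewrite in_itv/= -ltr_distl.
exists (q, n) => //; rewrite ifT; first exact: qx.
rewrite inE => y qy; apply: xeO => i.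
rewrite -(subrKA (cen q ord0 i)) (le_lt_trans (ler_normD _ _))// (splitr e).
by rewrite ltrD// (lt_trans _ ne)// 1?distrC ?qx//; exact: qy.
Qed.

Lemma lebesgueN_cube_gt0 N (x : 'rV[R]_N) r : 0 < r ->
  (0 < lebesgueN N (cube x r))%E.
Proof.
move=> r0; elim: N x => [|N IH] x /=.
  by rewrite diracE mem_set//= => -[].
pose x' : 'rV[R]_N := \row_j x ord0 (lift ord0 j).
rewrite /lebesgueS /pushforward.
rewrite (_ : consrV @^-1` _ = ball (x ord0 ord0) r `*` cube x' r); last first.
  have c0 z : @consrV _ N z ord0 ord0 = z.1.
    by rewrite /consrV mxE; case: splitP => // k _; rewrite mxE (ord1 k) eqxx mulr1n.
  have cS z i : @consrV _ N z ord0 (lift ord0 i) = z.2 ord0 i.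
    rewrite /consrV (_ : lift ord0 i = rshift 1 i); last exact: val_inj.
    by rewrite (@row_mxEr _ 1 1 N).
  apply/seteqP; split=> z /=.
    move=> xz; split=> [|i]; first by have := xz ord0; rewrite c0.
    by have := xz (lift ord0 i); rewrite cS mxE.
  move=> [z1 z2] i; case: (unliftP ord0 i) => [j|] ->; last by rewrite c0.
  by have := z2 j; rewrite cS mxE.
rewrite product_measure1E//; first last.
- exact: measurable_cube.
- exact: measurable_ball.
rewrite mule_gt0//.
rewrite [ltRHS](_ : _ = (r *+ 2)%:E) ?lte_fin ?mulrn_wgt0//.
by apply: lebesgue_measure_ball; exact: ltW.
Qed.

End cubes.

(** * Euclidean balls and the enlarged domain *)

Section geometry.
Context {R : realType} {N : nat}.
Local Notation V := 'rV[R]_N.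
Local Notation mu := (@lebesgueN R N).

Lemma enorm_continuous : continuous (@enorm R N).
Proof.
have cE : continuous (fun x : V => edot x x).
  rewrite /edot; elim: (index_enum _) => [|i r IH].
    rewrite (_ : (fun _ => _) = cst 0); first exact: cst_continuous.
    by apply/funext => x; rewrite big_nil.
  rewrite (_ : (fun _ => _) =
      fun x : V => x ord0 i * x ord0 i + \sum_(j <- r) x ord0 j * x ord0 j).
    by move=> x; apply: cvgD (IH x); apply: cvgM; exact: coord_continuous.
  by apply/funext => x; rewrite big_cons.
move=> x; apply: (@continuous_comp _ _ _ (fun x => edot x x)); first exact: cE.
exact: sqrt_continuous.
Qed.

Lemma open_eball (x : V) r : open (eball x r).
Proof.
rewrite (_ : eball x r = (fun y => enorm (y - x)) @^-1` `]-oo, r[); last first.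
  by apply/seteqP; split=> y; rewrite /eball/= in_itv.
apply: open_comp; last exact: interval_open.
move=> y _; apply: (@continuous_comp _ _ _ (fun y : V => y - x) enorm y).
  exact: (cvgB cvg_id (cvg_cst x)).
exact: enorm_continuous.
Qed.

Lemma enormZ (t : R) (x : V) : enorm (t *: x) = `|t| * enorm x.
Proof.
rewrite /enorm -sqrtr_sqr -sqrtrM ?sqr_ge0//; congr Num.sqrt.
rewrite /edot mulr_sumr; apply: eq_bigr => i _; rewrite !mxE; ring.
Qed.

Lemma enorm_gt0 (z : V) : z != 0 -> 0 < enorm z.
Proof.
move=> z0; rewrite sqrtr_gt0 lt_neqAle; apply/andP; split; last first.
  by apply: sumr_ge0 => i _; rewrite -expr2 sqr_ge0.
apply: contra z0; rewrite eq_sym psumr_eq0 => [/allP zz|i _]; last first.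
  by rewrite -expr2 sqr_ge0.
apply/eqP/rowP => i; rewrite mxE; have := zz i; rewrite mem_index_enum => /(_ isT).
by rewrite mulf_eq0 orbb => /eqP.
Qed.

Lemma open_enlarge (Omega : set V) delta : open Omega -> open (enlarge Omega delta).
Proof.
by move=> oO; apply: openU => //; apply: bigcup_open => q _; exact: open_eball.
Qed.

(** A segment of length less than [delta] that leaves [Omega] crosses its
    boundary, hence ends within [delta] of a boundary point. *)
Lemma eball_sub_enlarge (Omega : set V) delta (x : V) :
  open Omega -> Omega x -> eball x delta `<=` enlarge Omega delta.
Proof.
move=> oO Ox y xy; have [Oy|nOy] := pselect (Omega y); [by left|right].
pose ga (t : R) : V := x + t *: (y - x).
have cga : continuous ga.
  by move=> t; exact: (cvgD (cvg_cst x) (scalel_continuous (x := y - x) (x0 := t))).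
have ga0 : ga 0 = x by rewrite /ga scale0r addr0.
have ga1 : ga 1 = y by rewrite /ga scale1r subrKC.
pose A := [set t : R | 0 <= t <= 1 /\ Omega (ga t)].
have A0 : A 0 by split; rewrite ?lexx ?ler01// ga0.
have ubA : has_ubound A by exists 1 => t [/andP[]].
have supA : has_sup A by split => //; exists 0.
(* The point ga t0 is in the closure of Omega, but not in Omega. *)
pose t0 := sup A.
have t00 : 0 <= t0 by exact: ub_le_sup.
have t01 : t0 <= 1 by apply: ge_sup => [|t [/andP[]]//]; exists 0.
have clt : closure Omega (ga t0).
  move=> B /cga/nbhs_ballP[eps /= e0 gaB].
  have [t [t1 Ot] tt] := sup_adherent e0 supA.
  exists (ga t); split => //; apply: gaB.
  rewrite /ball/= ger0_norm ?subr_ge0; last by apply: ub_le_sup => //; split.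
  by rewrite ltrBlDr -ltrBlDl.
have nOt : ~ Omega (ga t0).
  move=> Ot; have t0lt : t0 < 1.
    by rewrite lt_neqAle t01 andbT; apply/negP => /eqP t0E; move: Ot; rewrite t0E ga1.
  have /cga/nbhs_ballP[eps /= e0 gaO] := oO _ Ot.
  pose d := Num.min (1 - t0) (eps / 2).
  have d0 : 0 < d by rewrite lt_min subr_gt0 t0lt divr_gt0.
  have : A (t0 + d).
    split; first by rewrite addr_ge0 ?(ltW d0)//= -lerBrDl ge_min lexx.
    apply: gaO; rewrite /ball/= opprD addNKr normrN gtr0_norm//.
    by rewrite gt_min ltr_pdivrMr// ltr_pMr// ltr1n orbT.
  by move=> /(ub_le_sup ubA); rewrite -/t0 leNgt ltrDl d0.
exists (ga t0); first by split => //; apply: contra_not nOt; exact: interior_subset.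
rewrite /eball/= (_ : y - ga t0 = (1 - t0) *: (y - x)); last first.
  by rewrite scalerBl scale1r /ga opprD addrA.
rewrite enormZ (le_lt_trans _ xy)// ler_piMl ?sqrtr_ge0//.
by rewrite ger0_norm ?subr_ge0// gerBl.
Qed.

Lemma open_lebesgueN_gt0 (O : set V) : open O -> O !=set0 -> (0 < mu O)%E.
Proof.
move=> oO [x /oO /nbhs_ballP[r /= r0]]; rewrite ball_cube// => rO.
apply: lt_le_trans (lebesgueN_cube_gt0 x r0) _.
apply: le_measure => //; rewrite inE.
  exact: measurable_cube.
exact: open_measurable_rV.
Qed.

Lemma bounded_coord (A : set V) (i : 'I_N) : bounded_set A ->
  exists M, forall x, A x -> `|x ord0 i| < M.
Proof.
move=> [M0 [_ AM]]; pose M := `|M0| + 1.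
have MA : M0 < M by rewrite (le_lt_trans (ler_norm _))// ltrDl.
exists (M + 1) => x /(AM _ MA) xM.
have : ball (0 : V) (M + 1) x.
  by rewrite mx_norm_ball /ball_/= sub0r normrN (le_lt_trans xM)// ltrDl.
by move=> [_ /(_ ord0 i)]; rewrite /ball/= mxE sub0r normrN.
Qed.

(** Vanishing propagates into [Omega] by slabs. If [v] is null almost everywhere
    beyond the hyperplane at height [t] in some coordinate direction, then every
    point of [Omega] above [t - delta / 2] sees a nonempty open part of its
    [delta]-ball beyond that hyperplane, where [v] vanishes whether or not the
    points lie in [Omega]. The induction starts above the bounded set [Omega] and
    crosses it in finitely many steps. *)
Lemma locally_constant_ae0 (Omega : set V) delta (v : V -> R) (i0 : 'I_N) :
  0 < delta -> bounded_set Omega ->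
  {ae mu, forall x, Omega x ->
    {ae mu, forall y, eball x delta y -> v y = v x}} ->
  {ae mu, forall x, ~ Omega x -> v x = 0} ->
  {ae mu, forall x, v x = 0}.
Proof.
move=> delta0 bO vO v0; have [M OM] := bounded_coord i0 bO.
pose P n := {ae mu, forall x, Omega x -> M - n%:R * (delta / 2) < x ord0 i0 -> v x = 0}.
have PA n : P n.
  elim: n => [|n IH].
    apply/aeW => x /OM; rewrite mul0r subr0 => xM /(lt_trans xM).
    by rewrite ltNge ler_norm.
  apply: filterS vO => x vOx Ox Mx; have {}vOx := vOx Ox.
  pose O := eball x delta `&` [set y : V | M - n%:R * (delta / 2) < y ord0 i0].
  have oO : open O.
    apply: openI; first exact: open_eball.
    rewrite (_ : [set y | _] =
        (fun y : V => y ord0 i0) @^-1` `]M - n%:R * (delta / 2), +oo[).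
      by apply: open_comp; [move=> *; exact: coord_continuous|exact: interval_open].
    by apply/seteqP; split=> y; rewrite /= in_itv/= andbT.
  have O0 : O !=set0.
    exists (x + (delta / 2) *: delta_mx ord0 i0); split.
      rewrite /eball/= addrC addKr enormZ /enorm /edot.
      rewrite (bigD1 i0)//= big1 ?addr0; last first.
        by move=> j /negPf ji; rewrite mxE ji andbF mulr0.
      by rewrite mxE !eqxx mul1r sqrtr1 mulr1 gtr0_norm; lra.
    rewrite /= !mxE !eqxx mulr1 -ltrBlDr (le_lt_trans _ Mx)//.
    by rewrite -[n.+1%:R]natr1 mulrDl mul1r opprD addrA.
  have [y [vy1 vy2 vy3 Oy]] : exists y, [/\ eball x delta y -> v y = v x,
     Omega y -> M - n%:R * (delta / 2) < y ord0 i0 -> v y = 0,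
     ~ Omega y -> v y = 0 & O y].
    apply: contrapT => /forallNP nE.
    have : {ae mu, forall y, ~ O y}.
      by apply: filterS3 vOx IH v0 => y ? ? ? Oy; apply: (nE y).
    move=> [A [mA A0 sA]].
    have := open_lebesgueN_gt0 oO O0; rewrite lt_neqAle => /andP[/eqP + _]; apply.
    apply/esym/(subset_measure0 _ _ _ A0) => //; first exact: open_measurable_rV.
    by apply: subset_trans sA => z Oz; apply.
  case: Oy => By Hy; rewrite -(vy1 By).
  by have [Oy|Oy] := pselect (Omega y); [exact: vy2|exact: vy3].
have := ae_foralln PA => PAe.
apply: filterS2 PAe v0 => x Px v0x.
have [Ox|] := pselect (Omega x); last exact: v0x.
pose n := Num.truncn (M *+ 2 / (delta / 2)).
apply: (Px n.+1 Ox).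
have : M *+ 2 < n.+1%:R * (delta / 2) by rewrite -ltr_pdivrMr ?divr_gt0// truncnS_gt.
have : - M < x ord0 i0 by have := OM _ Ox; rewrite ltr_norml => /andP[].
lra.
Qed.

End geometry.

Lemma enorm_neq0_dim (R : realType) N (e : 'rV[R]_N) : enorm e != 0 -> (0 < N)%N.
Proof. by case: N e => // e; rewrite /enorm /edot big_ord0 sqrtr0 eqxx. Qed.

(** * Weighted p-th powers and Bregman divergences *)

(** Along a subsequence whose integrals are dominated by [1 / 2 ^ (i + 1)] the sum
    of the functions is integrable, hence finite almost everywhere. *)
Lemma integral_cvg0_subseq d (T : measurableType d) (R : realType)
    (nu : {measure set T -> \bar R}) (f : nat -> T -> R) :
  (forall j, measurable_fun setT (f j)) -> (forall j x, 0 <= f j x) ->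
  (\int[nu]_x (f j x)%:E)%E @[j --> \oo] --> 0%E ->
  exists2 n_ : nat -> nat, n_ i @[i --> \oo] --> \oo &
    {ae nu, forall x, f (n_ i) x @[i --> \oo] --> 0}.
Proof.
move=> mf f0 cf.
have nP i : exists n, (i <= n)%N /\
    (\int[nu]_x (f n x)%:E <= (1 / (2 ^ (i + 1))%:R)%:E)%E.
  have : \forall n \near \oo, (\int[nu]_x (f n x)%:E <= (1 / (2 ^ (i + 1))%:R)%:E)%E.
    have /fine_cvgP[ffin /cvgrPdist_le/(_ (1 / (2 ^ (i + 1))%:R))] := cf.
    rewrite divr_gt0// ?ltr0n ?expn_gt0// => /(_ isT) fle.
    near=> n.
    have fin : (\int[nu]_x (f n x)%:E)%E \is a fin_num by near: n.
    rewrite -[leLHS]fineK// lee_fin (le_trans (ler_norm _))//.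
    by rewrite -normrN -sub0r; near: n.
  move=> ev; have [n [? ?]] := filter_ex (filterI (nbhs_infty_ge i) ev).
  by exists n.
pose n_ i := sval (cid (nP i)).
have n_ge i : (i <= n_ i)%N by rewrite /n_; case: (cid _) => /= ? [].
have n_le i : (\int[nu]_x (f (n_ i) x)%:E <= (1 / (2 ^ (i + 1))%:R)%:E)%E.
  by rewrite /n_; case: (cid _) => /= ? [].
exists n_.
  move=> A [k _ kA]; exists k => // i /= ki; apply: kA => /=.
  exact: leq_trans (n_ge i).
pose S (x : T) : \bar R := (\sum_(0 <= i <oo) (f (n_ i) x)%:E)%E.
have msum : measurable_fun [set: T] S.
  apply: (@ge0_emeasurable_sum _ _ _ _ (fun i x => (f (n_ i) x)%:E) xpredT)
    => [i x _ _|i _].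
    by rewrite lee_fin.
  by apply/measurable_EFinP.
have : nu.-integrable setT S.
  apply/integrableP; split => //.
  under eq_integral.
    move=> x _; rewrite gee0_abs; last by apply: nneseries_ge0 => *; rewrite lee_fin.
    over.
  rewrite integral_nneseries//; last 2 first.
  - by move=> n; apply/measurable_EFinP.
  - by move=> *; rewrite lee_fin.
  apply: (@le_lt_trans _ _ (\sum_(0 <= i <oo) (1 / (2 ^ (i + 1))%:R)%:E)%E).
    apply: lee_nneseries => i _; last exact: n_le.
    by move=> _; apply: integral_ge0 => *; rewrite lee_fin.
  have /cvg_lim -> // := @cvg_geometric_eseries_half R 1 0.
  by rewrite ltry.
move=> /integrable_ae => /(_ measurableT); apply: filterS => x /(_ I) fx.
apply: cvg_series_cvg_0; apply: nnseries_is_cvg => //.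
by rewrite -ge0_fin_numE//; apply: nneseries_ge0 => *; rewrite lee_fin.
Unshelve. all: by end_near. Qed.

Section weighted.
Context d (T : measurableType d) (R : realType).
Variables (nu : {measure set T -> \bar R}) (p : R) (W : T -> R).
Hypotheses (p1 : 1 < p) (mW : measurable_fun setT W) (W0 : forall z, 0 <= W z).

Definition pfinite (a : T -> R) :=
  measurable_fun setT a /\ (\int[nu]_z (W z * `|a z| `^ p)%:E < +oo)%E.

Lemma measurable_normr_powR q (a : T -> R) :
  measurable_fun setT a -> measurable_fun setT (fun z => `|a z| `^ q).
Proof.
by move=> ma; apply: (measurableT_comp (measurable_powR q)); exact: measurableT_comp.
Qed.

Lemma measurable_dpow (a : T -> R) :
  measurable_fun setT a -> measurable_fun setT (fun z => dpow p (a z)).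
Proof. by move=> ma; apply: measurable_funM => //; exact: measurable_normr_powR. Qed.

Lemma pfinite_integrable (a : T -> R) : pfinite a ->
  nu.-integrable setT (EFin \o (fun z => W z * `|a z| `^ p)).
Proof.
move=> [ma aoo]; apply/integrableP; split.
  by apply/measurable_EFinP/measurable_funM => //; exact: measurable_normr_powR.
apply: le_lt_trans aoo; rewrite le_eqVlt; apply/orP; left; apply/eqP.
by apply: eq_integral => z _ /=; rewrite ger0_norm// mulr_ge0// powR_ge0.
Qed.

Let iZ (c : R) (f : T -> R) : nu.-integrable setT (EFin \o f) ->
  nu.-integrable setT (EFin \o (fun z => c * f z)).
Proof.
move=> i; rewrite (_ : _ \o _ = (fun z => c%:E * (EFin \o f) z)%E) //.
exact: integrableZl.
Qed.

Let iB (f g : T -> R) : nu.-integrable setT (EFin \o f) ->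
  nu.-integrable setT (EFin \o g) ->
  nu.-integrable setT (EFin \o (fun z => f z - g z)).
Proof.
move=> fi gi; rewrite (_ : _ \o _ = (fun z => (EFin \o f) z - (EFin \o g) z)%E) //.
exact: integrableB.
Qed.

Let iD (f g : T -> R) : nu.-integrable setT (EFin \o f) ->
  nu.-integrable setT (EFin \o g) ->
  nu.-integrable setT (EFin \o (fun z => f z + g z)).
Proof.
move=> fi gi; rewrite (_ : _ \o _ = (EFin \o f) \+ (EFin \o g))%E //.
exact: integrableD.
Qed.

Lemma le_pfinite (a b : T -> R) (c : T -> R) (K : R) : pfinite a -> pfinite b ->
  measurable_fun setT c ->
  (forall z, `|c z| <= K * (`|a z| `^ p + `|b z| `^ p)) ->
  nu.-integrable setT (EFin \o (fun z => W z * c z)).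
Proof.
move=> fa fb mc cab.
apply: (@le_integrable _ _ _ _ _ _ _
  (EFin \o (fun z => K * (W z * `|a z| `^ p + W z * `|b z| `^ p)))) => //.
- by apply/measurable_EFinP/measurable_funM.
- move=> z _ /=; rewrite lee_fin normrM ger0_norm// -mulrDr mulrCA.
  by rewrite (le_trans _ (ler_norm _))// ler_wpM2l.
- by apply: iZ; apply: iD; exact: pfinite_integrable.
Qed.

Lemma pfiniteB (a b : T -> R) : pfinite a -> pfinite b -> pfinite (a \- b).
Proof.
move=> fa fb; have mab : measurable_fun setT (a \- b).
  by apply: measurable_funB; [case: fa|case: fb].
split=> //.
have /integrableP[_] : nu.-integrable setT
    (EFin \o (fun z => W z * `|(a \- b) z| `^ p)).
  apply: (@le_pfinite a b _ (2 `^ p)) => //; first exact: measurable_normr_powR.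
  by move=> z; rewrite ger0_norm ?powR_ge0// normB_powR_le.
apply: le_lt_trans; apply: ge0_le_integral => //.
- by move=> z _; rewrite lee_fin mulr_ge0// powR_ge0.
- by apply/measurable_EFinP/measurable_funM => //; exact: measurable_normr_powR.
- apply: measurableT_comp => //.
  by apply/measurable_EFinP/measurable_funM => //; exact: measurable_normr_powR.
- by move=> z _ /=; rewrite lee_fin ler_norm.
Qed.

Lemma integrable_dpow (a b : T -> R) : pfinite a -> pfinite b ->
  nu.-integrable setT (EFin \o (fun z => W z * (dpow p (a z) * b z))).
Proof.
move=> fa fb; apply: (@le_pfinite a b _ 1) => //.
  by apply: measurable_funM; [apply: measurable_dpow; case: fa|case: fb].
by move=> z; rewrite mul1r dpow_mul_le.
Qed.

Let bregE (a b : T -> R) z : W z * bregman p (a z) (b z) =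
  p^-1 * (W z * `|b z| `^ p) - p^-1 * (W z * `|a z| `^ p)
  - W z * (dpow p (a z) * (b \- a) z).
Proof. by rewrite /bregman/=; ring. Qed.

Lemma integrable_bregman (a b : T -> R) : pfinite a -> pfinite b ->
  nu.-integrable setT (EFin \o (fun z => W z * bregman p (a z) (b z))).
Proof.
move=> fa fb; under [X in EFin \o X]funext do rewrite bregE.
apply: iB; first by apply: iB; apply: iZ; exact: pfinite_integrable.
exact: (integrable_dpow fa (pfiniteB fb fa)).
Qed.

Lemma Rintegral_bregman (a b : T -> R) : pfinite a -> pfinite b ->
  \int[nu]_z (W z * bregman p (a z) (b z)) =
  p^-1 * \int[nu]_z (W z * `|b z| `^ p) - p^-1 * \int[nu]_z (W z * `|a z| `^ p)
  - \int[nu]_z (W z * (dpow p (a z) * (b \- a) z)).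
Proof.
move=> fa fb; under eq_Rintegral do rewrite bregE.
have ia := pfinite_integrable fa; have ib := pfinite_integrable fb.
rewrite RintegralB//; first by rewrite RintegralB ?RintegralZl//; exact: iZ.
- by apply: iB; exact: iZ.
- exact: (integrable_dpow fa (pfiniteB fb fa)).
Qed.

(** The integrands tend to [0] almost everywhere along a subsequence, and at the
    same time to [W * bregman a b] by continuity; strict convexity concludes. *)
Lemma Rintegral_bregman_cvg0 (a b : T -> R) (b_ : nat -> T -> R) :
  pfinite a -> (forall j, pfinite (b_ j)) ->
  {ae nu, forall z, W z != 0 -> b_ j z @[j --> \oo] --> b z} ->
  \int[nu]_z (W z * bregman p (a z) (b_ j z)) @[j --> \oo] --> 0 ->
  {ae nu, forall z, W z != 0 -> a z = b z}.
Proof.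
move=> fa fb bb cv0.
pose F j z := W z * bregman p (a z) (b_ j z).
have iF j : nu.-integrable setT (EFin \o F j) by exact: (integrable_bregman fa (fb j)).
have [n_ n_cvg nF] : exists2 n_ : nat -> nat, n_ i @[i --> \oo] --> \oo &
    {ae nu, forall x, F (n_ i) x @[i --> \oo] --> 0}.
  apply: integral_cvg0_subseq.
  - by move=> j; apply/measurable_EFinP; case/integrableP: (iF j).
  - by move=> j z; rewrite mulr_ge0// bregman_ge0.
  - apply/fine_cvgP; split; last exact: cv0.
    by apply: nearW => j; exact: integrable_fin_num (iF j).
apply: filterS2 bb nF => z bz Fz Wz; have {}bz := bz Wz.
have bnz : b_ (n_ i) z @[i --> \oo] --> b z by exact: (cvg_comp n_ (b_^~ z) n_cvg bz).
have cF : F (n_ i) z @[i --> \oo] --> W z * bregman p (a z) (b z).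
  apply: cvgM; first exact: cvg_cst.
  apply: cvgB; last by apply: cvgM; [exact: cvg_cst|apply: cvgB => //; exact: cvg_cst].
  apply: cvgB; last exact: cvg_cst.
  apply: cvgM; first exact: cvg_cst.
  exact: (cvg_comp _ (fun x => `|x| `^ p) bnz (@normr_powR_continuous _ _ p1 (b z))).
have /eqP : W z * bregman p (a z) (b z) = 0 by exact: (cvg_unique _ cF Fz).
by rewrite mulf_eq0 (negPf Wz)/= => /eqP/(bregman_eq0 p1).
Qed.

End weighted.

(** * Lebesgue spaces on a subset *)

Section Lp_restriction.
Context {R : realType} {N : nat}.
Local Notation V := 'rV[R]_N.
Local Notation mu := (@lebesgueN R N).
Implicit Types (D E : set V) (f g v : V -> R) (p q : R).

Definition Lp_norm D p f : R := fine 'N[mu]_p%:E[EFin \o f \_ D].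

Lemma restrict_subr D f g : (f \- g) \_ D = f \_ D \- g \_ D.
Proof. by apply/funext => x /=; rewrite !patchE; case: ifP => // _; rewrite subr0. Qed.

Lemma Lp_finite_norm D p f : Lp D p f ->
  ('N[mu]_p%:E[EFin \o f \_ D])%E = (Lp_norm D p f)%:E.
Proof.
by rewrite /Lp/= => /andP[_] /[!inE] foo; rewrite fineK// ge0_fin_numE// Lnorm_ge0.
Qed.

Lemma Lp_norm_ge0 D p f : 0 <= Lp_norm D p f.
Proof. by rewrite fine_ge0// Lnorm_ge0. Qed.

Lemma LpP D p f : measurable D -> 0 < p -> Lp D p f <->
  measurable_fun D f /\ (\int[mu]_(x in D) (`|f x| `^ p)%:E < +oo)%E.
Proof.
move=> mD p0.
have -> : (\int[mu]_(x in D) (`|f x| `^ p)%:E = 'N[mu]_p%:E[EFin \o f \_ D] `^ p)%E.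
  rewrite (poweR_Lnorm mu _ (lt0r_neq0 p0)) [LHS]integral_mkcond.
  apply: eq_integral => x _.
  by rewrite /= !patchE; case: ifP => // _; rewrite normr0 powR0// gt_eqF.
split=> [/andP[] /[!inE] mf foo|[mf foo]].
  by split; [apply/measurable_restrictT|exact: poweR_lty].
apply/andP; split; rewrite inE; first exact: (measurable_restrictT f mD).1 mf.
by apply: lty_poweRy foo; rewrite gt_eqF.
Qed.

Lemma LpB D p f g : 1 <= p -> Lp D p f -> Lp D p g -> Lp D p (f \- g).
Proof.
move=> p1 Lf Lg; rewrite /Lp/= restrict_subr.
have p1' : (1 <= p%:E)%E by rewrite lee_fin.
have := (Lfun_submod_closed mu p1').2 (-1) (g \_ D) (f \_ D) Lg Lf.
by rewrite scaleN1r addrC.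
Qed.

Lemma Lp_subset D E p f : measurable D -> measurable E -> D `<=` E -> 0 < p ->
  Lp E p f -> Lp D p f.
Proof.
move=> mD mE DE p0 /(LpP _ mE p0)[mf foo]; apply/(LpP _ mD p0).
split; first exact: measurable_funS mf.
apply: le_lt_trans foo; apply: ge0_subset_integral => //.
by apply/measurable_EFinP/(measurableT_comp (measurable_powR p))/measurableT_comp.
Qed.

Lemma Lp_norm_powR D p f : measurable D -> 0 < p -> Lp D p f ->
  (\int[mu]_(x in D) (`|f x| `^ p)%:E = (Lp_norm D p f `^ p)%:E)%E.
Proof.
move=> mD p0 Lf; rewrite -poweR_EFin -(Lp_finite_norm Lf).
rewrite (poweR_Lnorm mu _ (lt0r_neq0 p0)).
rewrite [LHS]integral_mkcond; apply: eq_integral => x _.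
by rewrite /= !patchE; case: ifP => // _; rewrite normr0 powR0// gt_eqF.
Qed.

Lemma Lp_hoelder D p q f v : measurable D -> 0 < p -> 0 < q -> p^-1 + q^-1 = 1 ->
  Lp D p f -> Lp D q v ->
  mu.-integrable D (EFin \o (fun x => f x * v x)) /\
  `|\int[mu]_(x in D) (f x * v x)| <= Lp_norm D p f * Lp_norm D q v.
Proof.
move=> mD p0 q0 pq Lf Lv.
have [mf _] := (LpP f mD p0).1 Lf; have [mv _] := (LpP v mD q0).1 Lv.
have mfv : measurable_fun D (EFin \o (fun x => f x * v x)).
  by apply/measurable_EFinP/measurable_funM.
have bnd : (\int[mu]_(x in D) `|(f x * v x)%:E| <=
    (Lp_norm D p f * Lp_norm D q v)%:E)%E.
  have := hoelder mu ((measurable_restrictT f mD).1 mf)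
    ((measurable_restrictT v mD).1 mv) p0 q0 pq.
  rewrite Lp_finite_norm// Lp_finite_norm// -EFinM; apply: le_trans.
  rewrite le_eqVlt Lnorm1 [X in X == _]integral_mkcond; apply/orP; left; apply/eqP.
  apply: eq_integral => x _ /=; rewrite !patchE.
  by case: ifP => // _; rewrite mul0r normr0.
have ifv : mu.-integrable D (EFin \o (fun x => f x * v x)).
  by apply/integrableP; split => //; rewrite (le_lt_trans bnd)// ltry.
split => //; rewrite -lee_fin EFin_normr_Rintegral// (le_trans _ bnd)//.
exact: le_abse_integral.
Qed.

Lemma Lp_norm_le D q (C : R) f :
  measurable D -> 0 < q -> Lp D q f ->
  (\int[mu]_(x in D) (`|f x| `^ q)%:E < C%:E)%E ->
  Lp_norm D q f <= C `^ q^-1.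
Proof.
move=> mD q0 Lf; rewrite Lp_norm_powR// lte_fin => fC.
rewrite -[leLHS]powRr1 ?Lp_norm_ge0// -(mulfV (lt0r_neq0 q0)) powRrM.
have C0 : 0 <= C by rewrite (le_trans _ (ltW fC))// powR_ge0.
by apply: ge0_ler_powR; rewrite ?invr_ge0 ?(ltW q0) ?nnegrE ?powR_ge0 ?(ltW fC).
Qed.

Lemma Lp_cvg_subseq D p (f_ : nat -> V -> R) f : measurable D -> 1 < p ->
  (forall j, Lp D p (f_ j)) -> Lp D p f -> strong_cvg_Lp D p f_ f ->
  exists2 n_ : nat -> nat, n_ i @[i --> \oo] --> \oo &
    {ae mu, forall x, D x -> f_ (n_ i) x @[i --> \oo] --> f x}.
Proof.
move=> mD p1 Lf_ Lf cf; have p0 : 0 < p by exact: lt_trans p1.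
have Lfj j : Lp D p (f_ j \- f) by apply: LpB => //; exact: ltW.
have [n_ n_cvg nf] : exists2 n_ : nat -> nat, n_ i @[i --> \oo] --> \oo &
    {ae mu, forall x, (`|((f_ (n_ i) \- f) \_ D) x| `^ p) @[i --> \oo] --> 0}.
  apply: (integral_cvg0_subseq (f := fun j x => `|((f_ j \- f) \_ D) x| `^ p)).
  - move=> j; apply: measurable_normr_powR; apply: (measurable_restrictT _ mD).1.
    exact: ((LpP _ mD p0).1 (Lfj j)).1.
  - by move=> *; exact: powR_ge0.
  - rewrite (_ : (fun j => _) = fun j => (Lp_norm D p (f_ j \- f) `^ p)%:E); last first.
      apply/funext => j; rewrite -(Lp_norm_powR mD p0 (Lfj j)) [in RHS]integral_mkcond.
      apply: eq_integral => x _; rewrite !patchE /=; case: ifP => // _.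
      by rewrite normr0 powR0// gt_eqF.
    apply/fine_cvgP; split; first by apply: nearW.
    have c0 : Lp_norm D p (f_ j \- f) @[j --> \oo] --> 0 by exact: (fine_cvg cf).
    have := cvg_comp _ (fun t => `|t| `^ p) c0 (@normr_powR_continuous _ _ p1 0).
    rewrite /= normr0 powR0 ?gt_eqF//; apply: cvg_trans; apply: near_eq_cvg.
    by apply: nearW => j /=; rewrite ger0_norm// Lp_norm_ge0.
exists n_ => //; apply: filterS nf => x fx Dx.
apply/cvgrPdist_lt => eps eps0; have /cvgrPdist_lt/(_ (eps `^ p)) := fx.
rewrite powR_gt0// => /(_ isT); apply: filterS => i.
rewrite sub0r normrN patchE mem_set//= ger0_norm ?powR_ge0// distrC.
rewrite ltNge => /negP lt_eps; rewrite ltNge; apply/negP => le_eps; apply: lt_eps.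
by apply: ge0_ler_powR => //; rewrite ?nnegrE ?(ltW eps0)// ltW.
Qed.

End Lp_restriction.

(** * The nonlocal form on the product space *)

Section product_ae.
Context {R : realType} {N : nat}.
Local Notation V := 'rV[R]_N.
Local Notation mu := (@lebesgueN R N).
Local Notation nu := (mu \x mu)%E.

Lemma ae_prod (P : V -> Prop) : {ae mu, forall x, P x} ->
  {ae nu, forall z : V * V, P z.1 /\ P z.2}.
Proof.
move=> [A [mA A0 PA]].
have n1 : nu.-negligible (A `*` [set: V]).
  exists (A `*` [set: V]); split => //; first exact: measurableX.
  rewrite product_measure1E//.
  by rewrite [X in (X * _)%E = _](A0 : _ = _) mul0e.
have n2 : nu.-negligible ([set: V] `*` A).
  exists ([set: V] `*` A); split => //; first exact: measurableX.
  rewrite product_measure1E//.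
  by rewrite [X in (_ * X)%E = _](A0 : _ = _) mule0.
apply: negligibleS (negligibleU n1 n2) => z /= /not_andP[nP|nP]; [left|right].
  by split => //; exact: PA.
by split => //; exact: PA.
Qed.

(** Tonelli: a function vanishing almost everywhere on the product has almost all
    its sections vanishing almost everywhere. *)
Lemma ae_prod_section (P : V -> V -> Prop) (F : V * V -> R) :
  measurable_fun setT F ->
  (forall x y, F (x, y) = 0 -> P x y) -> {ae nu, forall z, F z = 0} ->
  {ae mu, forall x, {ae mu, forall y, P x y}}.
Proof.
move=> mF FP F0.
have mF' : measurable_fun setT (fun z => `|(F z)%:E|%E).
  by apply: measurableT_comp => //; exact/measurable_EFinP.
have : (\int[nu]_z `|(F z)%:E| = 0)%E.
  apply/ae_eq_integral_abs => //; first exact/measurable_EFinP.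
  by apply: filterS F0 => z -> _.
rewrite (fubini_tonelli1 _ mF')//.
rewrite (eq_integral (fun x => `|fubini_F mu (fun z => `|(F z)%:E|%E) x|%E)); last first.
  by move=> x _; rewrite gee0_abs//; apply: integral_ge0.
move=> /(ae_eq_integral_abs _ measurableT (measurable_fun_fubini_tonelli_F _ mF' _)).
move=> /(_ (fun=> abse_ge0 _)); apply: filterS => x /(_ I) /= Fx.
have : ae_eq mu setT (fun y => (F (x, y))%:E) (cst 0%E).
  apply/ae_eq_integral_abs => //.
  by apply/measurable_EFinP; exact: (measurableT_comp mF (pair1_measurable x)).
by apply: filterS => y /(_ I)/= [/FP].
Qed.

End product_ae.

Section product_form.
Context {R : realType} {N : nat}.
Local Notation V := 'rV[R]_N.
Local Notation mu := (@lebesgueN R N).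
Local Notation nu := (mu \x mu)%E.
Variables (Omega : set V) (delta p : R) (k : R -> R).
Local Notation D := (enlarge Omega delta).
Hypotheses (mD : measurable D) (p1 : 1 < p)
  (mk : measurable_fun [set: V] (fun z => k (enorm z)))
  (k0 : forall z : V, 0 <= k (enorm z)).
Implicit Types (c : V -> V -> R) (u w : V -> R) (z : V * V).

(** The density of the form with respect to the product measure. The absolute
    value makes it nonnegative everywhere, whereas coefficients are controlled
    only almost everywhere. *)
Definition weight c : V * V -> R :=
  (fun z => `|c z.2 z.1| * k (enorm (z.2 - z.1)) / enorm (z.2 - z.1) `^ p)
  \_ (D `*` D).

Definition increment u z : R := (u \_ D) z.2 - (u \_ D) z.1.

Lemma weight_ge0 c z : 0 <= weight c z.
Proof.
rewrite /weight patchE; case: ifP => // _.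
by rewrite divr_ge0 ?mulr_ge0 ?powR_ge0.
Qed.

Lemma incrementB u w : increment (u \- w) = increment u \- increment w.
Proof. by apply/funext => z; rewrite /increment restrict_subr/=; ring. Qed.

Let mDD : measurable (D `*` D). Proof. exact: measurableX. Qed.

Let mdiff : measurable_fun [set: V * V] (fun z => z.2 - z.1).
Proof.
apply/measurable_fun_rVP => i.
rewrite (_ : (fun z => _) = fun z => z.2 ord0 i - z.1 ord0 i); last first.
  by apply/funext => z; rewrite !mxE.
apply: measurable_funB; apply: (measurableT_comp (measurable_coord i)).
  exact: measurable_snd.
exact: measurable_fst.
Qed.

Lemma measurable_increment u : measurable_fun D u ->
  measurable_fun setT (increment u).
Proof.
move=> /(measurable_restrictT u mD) mu_; apply: measurable_funB.
  exact: (measurableT_comp mu_ measurable_snd).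
exact: (measurableT_comp mu_ measurable_fst).
Qed.

Let mpow : measurable_fun setT (fun z => (enorm (z.2 - z.1) `^ p)^-1).
Proof.
rewrite (_ : (fun z => _) = (fun z => `|enorm (z.2 - z.1)| `^ - p)).
  by apply: measurable_normr_powR; exact: (measurableT_comp measurable_enorm mdiff).
by apply/funext => z; rewrite ger0_norm ?sqrtr_ge0// powRN.
Qed.

Let mker : measurable_fun setT (fun z => k (enorm (z.2 - z.1))).
Proof. exact: (measurableT_comp mk mdiff). Qed.

Lemma measurable_weight c : measurable_fun (D `*` D) (fun z => c z.2 z.1) ->
  measurable_fun setT (weight c).
Proof.
move=> mc; apply: (measurable_restrictT _ mDD).1.
apply: measurable_funM; last exact: measurable_funTS.
by apply: measurable_funM; [exact: measurableT_comp|exact: measurable_funTS].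
Qed.

Definition form_integrand c u w : V * V -> R :=
  (fun z => c z.2 z.1 * k (enorm (z.2 - z.1)) *
     (`|u z.2 - u z.1| `^ (p - 2) * (u z.2 - u z.1) / enorm (z.2 - z.1) `^ p) *
     (w z.2 - w z.1)) \_ (D `*` D).

Lemma form_integrandE c u w z : (D `*` D) z ->
  form_integrand c u w z = c z.2 z.1 * k (enorm (z.2 - z.1)) /
     enorm (z.2 - z.1) `^ p * (dpow p (increment u z) * increment w z).
Proof.
move=> Dz; rewrite /form_integrand patchE mem_set// /dpow /increment.
by case: Dz => ? ?; rewrite !patchE !mem_set//; ring.
Qed.

Lemma measurable_form_integrand c u w :
  measurable_fun (D `*` D) (fun z => c z.2 z.1) ->
  measurable_fun D u -> measurable_fun D w ->
  measurable_fun setT (form_integrand c u w).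
Proof.
move=> mc mu_ mw.
rewrite (_ : form_integrand c u w = (fun z => c z.2 z.1 * k (enorm (z.2 - z.1)) /
     enorm (z.2 - z.1) `^ p * (dpow p (increment u z) * increment w z)) \_ (D `*` D)).
  apply: (measurable_restrictT _ mDD).1; apply: measurable_funM.
    apply: measurable_funM; last exact: measurable_funTS.
    by apply: measurable_funM => //; exact: measurable_funTS.
  apply: measurable_funTS; apply: measurable_funM; last exact: measurable_increment.
  by apply: measurable_dpow; exact: measurable_increment.
apply/funext => z; have [Dz|Dz] := pselect ((D `*` D) z).
  by rewrite form_integrandE// patchE mem_set.
by rewrite /form_integrand !patchE memNset.
Qed.

Lemma nonlocal_form_iterated c u w : nonlocal_form Omega delta p k c u w =
  (\int[mu]_x \int[mu]_y (form_integrand c u w (x, y))%:E)%E.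
Proof.
rewrite /nonlocal_form integral_mkcond; apply: eq_integral => x _.
rewrite patchE; case: ifPn => Dx.
  rewrite integral_mkcond; apply: eq_integral => y _.
  rewrite patchE /form_integrand patchE; case: ifPn => Dy.
    by rewrite mem_set//=; split => /=; apply: set_mem.
  by rewrite memNset// => -[_] /= /mem_set; apply/negP.
rewrite integral0_eq// => y _; rewrite /form_integrand patchE memNset// => -[/= + _].
by move/mem_set; apply/negP.
Qed.

(** Fubini turns the iterated integral of the definition into an integral over the
    product; the almost everywhere sign of [c] absorbs the absolute value in
    [weight]. *)
Lemma nonlocal_form_prod c u w :
  measurable_fun (D `*` D) (fun z => c z.2 z.1) ->
  {ae nu, forall z, (D `*` D) z -> 0 <= c z.2 z.1} ->
  measurable_fun D u -> measurable_fun D w ->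
  nu.-integrable setT
    (EFin \o (fun z => weight c z * (dpow p (increment u z) * increment w z))) ->
  nonlocal_form Omega delta p k c u w =
  (\int[nu]_z (weight c z * (dpow p (increment u z) * increment w z))%R%:E)%E.
Proof.
move=> mc c0 mu_ mw iW.
have mF := measurable_form_integrand mc mu_ mw.
have aeE : {ae nu, forall z, form_integrand c u w z =
    weight c z * (dpow p (increment u z) * increment w z)}.
  apply: filterS c0 => z cz; have [Dz|Dz] := pselect ((D `*` D) z).
    by rewrite form_integrandE// /weight patchE mem_set// ger0_norm ?cz.
  by rewrite /form_integrand /weight !patchE memNset// mul0r.
have mW := measurable_int nu iW.
have iF : nu.-integrable setT (EFin \o form_integrand c u w).
  apply/integrableP; split; first exact/measurable_EFinP.
  case/integrableP: iW => _; apply: le_lt_trans.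
  rewrite le_eqVlt; apply/orP; left; apply/eqP; apply: ae_eq_integral => //.
  - by apply: measurableT_comp => //; exact/measurable_EFinP.
  - exact: measurableT_comp.
  - by apply: filterS aeE => z /= ->.
rewrite nonlocal_form_iterated (integral12_prod_meas1 iF).
apply: ae_eq_integral => //; first exact/measurable_EFinP.
by apply: filterS aeE => z /= ->.
Qed.

Let one_cst : measurable_fun (D `*` D) (fun z => (fun _ _ : V => 1 : R) z.2 z.1).
Proof. exact: measurable_cst. Qed.

(** On the diagonal the integrand is nonnegative, so Tonelli applies before any
    integrability is known. *)
Lemma formB_pfinite u : measurable_fun D u ->
  (Defs.formB Omega delta p k u u < +oo)%E ->
  pfinite nu p (weight (fun _ _ => 1)) (increment u).
Proof.
move=> mu_ Boo; split; first exact: measurable_increment.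
apply: le_lt_trans Boo; rewrite /Defs.formB nonlocal_form_iterated.
have F0 z : 0 <= form_integrand (fun _ _ => 1) u u z.
  have [Dz|Dz] := pselect ((D `*` D) z); last by rewrite /form_integrand patchE memNset.
  rewrite form_integrandE// dpow_mul// mul1r.
  by rewrite mulr_ge0 ?divr_ge0 ?powR_ge0.
have mF : measurable_fun setT (EFin \o form_integrand (fun _ _ => 1) u u).
  by apply/measurable_EFinP; exact: (measurable_form_integrand one_cst mu_ mu_).
rewrite -(fubini_tonelli1 _ mF) => [|z]; last by rewrite lee_fin.
rewrite le_eqVlt; apply/orP; left; apply/eqP; apply: eq_integral => z _ /=.
congr EFin; have [Dz|Dz] := pselect ((D `*` D) z).
  by rewrite form_integrandE// dpow_mul// /weight patchE mem_set// normr1.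
by rewrite /form_integrand /weight !patchE memNset// mul0r.
Qed.

Lemma weight_pfinite c (K : R) (a : V * V -> R) :
  measurable_fun (D `*` D) (fun z => c z.2 z.1) ->
  {ae nu, forall z, (D `*` D) z -> `|c z.2 z.1| <= K} -> 0 <= K ->
  pfinite nu p (weight (fun _ _ => 1)) a -> pfinite nu p (weight c) a.
Proof.
move=> mc cK K0 [ma aoo]; split=> //.
have mWa c' : measurable_fun (D `*` D) (fun z => c' z.2 z.1) ->
    measurable_fun setT (fun z => (weight c' z * `|a z| `^ p)%:E).
  move=> mc'; apply/measurable_EFinP/measurable_funM; first exact: measurable_weight.
  exact: measurable_normr_powR.
apply: (@le_lt_trans _ _
    (\int[nu]_z (K%:E * (weight (fun _ _ => 1) z * `|a z| `^ p)%:E))%E); last first.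
  rewrite ge0_integralZl//; first by rewrite lte_mul_pinfty// lee_fin.
  - exact: mWa.
  - by move=> z _; rewrite lee_fin mulr_ge0 ?powR_ge0 ?weight_ge0.
apply: ae_ge0_le_integral => //.
- by move=> z _; rewrite lee_fin mulr_ge0 ?powR_ge0 ?weight_ge0.
- exact: mWa.
- by move=> z _; rewrite -EFinM lee_fin !mulr_ge0 ?powR_ge0 ?weight_ge0.
- by apply: emeasurable_funM => //; exact: mWa.
- apply: filterS cK => z cz _; rewrite -EFinM lee_fin mulrA ler_wpM2r ?powR_ge0//.
  rewrite /weight !patchE; case: ifPn => [/set_mem/cz cKz|]; last by rewrite mulr0.
  by rewrite normr1 mul1r mulrA ler_wpM2r ?invr_ge0 ?powR_ge0// ler_wpM2r.
Qed.

End product_form.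

(** * States and energies *)

Section state_problem.
Context {R : realType} {N : nat}.
Local Notation V := 'rV[R]_N.
Local Notation mu := (@lebesgueN R N).
Local Notation nu := (mu \x mu)%E.
Variables (Omega : set V) (delta p : R) (k : R -> R).
Local Notation D := (enlarge Omega delta).
Local Notation q := (p / (p - 1)).
Hypotheses (oO : open Omega) (p1 : 1 < p)
  (mk : measurable_fun [set: V] (fun z => k (enorm z)))
  (k0 : forall z : V, 0 <= k (enorm z)).
Local Notation X := (spaceX Omega delta p k).
Local Notation X0 := (spaceX0 Omega delta p k).
Local Notation weight := (weight Omega delta p k).
Local Notation increment := (increment Omega delta).
Implicit Types u v w g : V -> R.

Let mO : measurable Omega. Proof. exact: open_measurable_rV. Qed.
Let mD : measurable D. Proof. by apply: open_measurable_rV; exact: open_enlarge. Qed.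
Let p0 : 0 < p. Proof. exact: lt_trans p1. Qed.
Let OD : Omega `<=` D. Proof. by move=> x; left. Qed.

Lemma conj_exp_gt1 : 1 < q.
Proof. by rewrite ltr_pdivlMr ?subr_gt0// mul1r gtrBl. Qed.

Lemma conj_expD : q^-1 + p^-1 = 1.
Proof. by rewrite invf_div mulrBl mul1r divff ?subrK// gt_eqF. Qed.

Lemma conj_expK : q / (q - 1) = p.
Proof.
have pm1 : p - 1 != 0 by rewrite subr_eq0 gt_eqF.
have -> : q - 1 = (p - 1)^-1 by field.
by rewrite invrK divfK.
Qed.

Let q0 : 0 < q. Proof. exact: lt_trans conj_exp_gt1. Qed.

Lemma spaceXP u : X u <->
  Lp D p u /\ pfinite nu p (weight (fun _ _ => 1)) (increment u).
Proof.
split=> -[Lu fu]; split=> //; have [mu_ _] := (LpP u mD p0).1 Lu.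
  exact: formB_pfinite fu.
have mW : measurable_fun setT (weight (fun _ _ => 1)) by apply: measurable_weight.
have W0 z : 0 <= weight (fun _ _ => 1) z by exact: weight_ge0.
have iW := integrable_dpow p1 mW W0 fu fu.
rewrite /Defs.formB (nonlocal_form_prod mD mk _ _ mu_ mu_ iW)//.
  by rewrite ltey_eq; apply/orP; left; exact: integrable_fin_num iW.
by apply: aeW => z _; exact: ler01.
Qed.

Lemma spaceXB u w : X u -> X w -> X (u \- w).
Proof.
move=> /spaceXP[Lu fu] /spaceXP[Lw fw]; apply/spaceXP; split.
  exact: LpB (ltW p1) Lu Lw.
rewrite incrementB; apply: pfiniteB => //; first by apply: measurable_weight.
by move=> z; exact: weight_ge0.
Qed.

Lemma affineX0_X u0 u : X u0 -> affineX0 Omega delta p k u0 u -> X u.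
Proof.
move=> Xu0 [w [Xw _] <-].
(* Sums are obtained from the stability under differences. *)
rewrite (_ : u0 \+ w = u0 \- ((u0 \- w) \- u0)); last by apply/funext => x /=; ring.
exact: (spaceXB Xu0 (spaceXB (spaceXB Xu0 Xw) Xu0)).
Qed.

Lemma affineX0B u0 u v : affineX0 Omega delta p k u0 u ->
  affineX0 Omega delta p k u0 v -> X0 (v \- u).
Proof.
move=> [w [Xw w0] <-] [w' [Xw' w'0] <-].
rewrite (_ : _ \- _ = w' \- w); last by apply/funext => x /=; ring.
split; first exact: spaceXB.
by apply: filterS2 w0 w'0 => x wx w'x Dx /=; rewrite wx// w'x// subrr.
Qed.

Lemma X_LpO u : X u -> Lp Omega p u.
Proof. by move=> /spaceXP[Lu _]; exact: Lp_subset Lu. Qed.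

Section coefficient_form.
Variables (hmin hmax : R) (h : V -> R).
Hypotheses (hmin0 : 0 < hmin) (hmax0 : 0 < hmax)
  (hh : coefficient Omega delta hmin hmax h).

Definition mean_coef (x' x : V) : R := (h x' + h x) / 2.

Lemma coefficient_bounds : {ae mu, forall x, D x -> 0 <= h x <= hmax}.
Proof.
case: hh => _ hO hD; apply: filterS2 hO hD => x hO hD Dx.
have [Ox|Ox] := pselect (Omega x).
  by have /andP[hx ->] := hO Ox; rewrite (le_trans (ltW hmin0)).
by rewrite hD// lexx ltW.
Qed.

Let mh : measurable_fun D h. Proof. by case: hh. Qed.

Let mcoef : measurable_fun (D `*` D) (fun z => mean_coef z.2 z.1).
Proof.
have mDD : measurable (D `*` D) by exact: measurableX.
have mhD := (measurable_restrictT h mD).1 mh.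
apply: (measurable_restrictT _ mDD).2.
rewrite [X in measurable_fun _ X](_ : _ =
    (fun z => ((h \_ D) z.2 + (h \_ D) z.1) / 2) \_ (D `*` D)).
  apply: (measurable_restrictT _ mDD).1; apply: measurable_funTS.
  apply: measurable_funM => //; apply: measurable_funD.
    exact: (measurableT_comp mhD measurable_snd).
  exact: (measurableT_comp mhD measurable_fst).
apply/funext => z; rewrite !patchE; case: ifP => // /set_mem[/= D1 D2].
by rewrite !mem_set.
Qed.

Let coef_bounds : {ae nu, forall z, (D `*` D) z -> 0 <= mean_coef z.2 z.1 <= hmax}.
Proof.
apply: filterS (ae_prod coefficient_bounds) => z [h1 h2] [D1 D2].
by have /andP[? ?] := h1 D1; have /andP[? ?] := h2 D2;
  apply/andP; split; rewrite /mean_coef; lra.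
Qed.

Lemma measurable_coef_weight : measurable_fun setT (weight mean_coef).
Proof. exact: measurable_weight. Qed.

Lemma coef_weight_ge0 z : 0 <= weight mean_coef z.
Proof. exact: weight_ge0. Qed.

Lemma X_pfinite u : X u -> pfinite nu p (weight mean_coef) (increment u).
Proof.
move=> /spaceXP[_]; apply: (weight_pfinite mD mk k0 mcoef (K := hmax)) => //;
  last exact: ltW.
by apply: filterS coef_bounds => z cz /cz/andP[c0 cm]; rewrite ger0_norm.
Qed.

Lemma formBhE u w : X u -> X w -> formBh Omega delta p k h u w =
  (\int[nu]_z (weight mean_coef z * (dpow p (increment u z) * increment w z)))%:E.
Proof.
move=> Xu Xw.
have [[/(LpP _ mD p0)[mu_ _] _] [/(LpP _ mD p0)[mw _] _]] := (Xu, Xw).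
have iW := integrable_dpow p1 measurable_coef_weight coef_weight_ge0
  (X_pfinite Xu) (X_pfinite Xw).
rewrite /formBh (nonlocal_form_prod mD mk mcoef _ mu_ mw iW)//.
  by rewrite /Rintegral fineK//; exact: integrable_fin_num iW.
by apply: filterS coef_bounds => z cz /cz/andP[].
Qed.

Definition form_power u : R := \int[nu]_z (weight mean_coef z * `|increment u z| `^ p).

Definition pairing g u : R := \int[mu]_(x in Omega) (g x * u x).

Definition energyR g u : R := p^-1 * form_power u - pairing g u.

Lemma pairing_bound g u : Lp Omega q g -> Lp Omega p u ->
  mu.-integrable Omega (EFin \o (fun x => g x * u x)) /\
  `|pairing g u| <= Lp_norm Omega q g * Lp_norm Omega p u.
Proof. by move=> Lg Lu; apply: Lp_hoelder => //; exact: conj_expD. Qed.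

Lemma pairingE g u : Lp Omega q g -> Lp Omega p u ->
  (\int[mu]_(x in Omega) (g x * u x)%:E)%E = (pairing g u)%:E.
Proof.
move=> Lg Lu; have [i _] := pairing_bound Lg Lu.
by rewrite /pairing /Rintegral fineK//; exact: integrable_fin_num i.
Qed.

Lemma pairingBr g u v : Lp Omega q g -> Lp Omega p u -> Lp Omega p v ->
  pairing g (u \- v) = pairing g u - pairing g v.
Proof.
move=> Lg Lu Lv; have [iu _] := pairing_bound Lg Lu; have [iv _] := pairing_bound Lg Lv.
rewrite /pairing -RintegralB//; apply: eq_Rintegral => x _ /=; ring.
Qed.

Lemma energyE g u : Lp Omega q g -> X u ->
  energy Omega delta p k h g u = (energyR g u)%:E.
Proof.
move=> Lg Xu; rewrite /energy formBhE// pairingE//; last exact: X_LpO.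
rewrite -EFinM -EFinB /energyR /form_power; congr (_ * _ - _)%:E.
by apply: eq_Rintegral => z _; rewrite dpow_mul.
Qed.

Definition bregman_gap u v : R :=
  \int[nu]_z (weight mean_coef z * bregman p (increment u z) (increment v z)).

Lemma bregman_gap_ge0 u v : 0 <= bregman_gap u v.
Proof.
by apply: Rintegral_ge0 => z _; rewrite mulr_ge0 ?bregman_ge0// coef_weight_ge0.
Qed.

(** The first-order terms of the energy at the state [u] in the admissible
    direction [v - u] cancel by the state equation; what remains is exactly the
    integrated Bregman divergence of the increments. *)
Lemma energyR_state u0 g u v : X u0 -> Lp Omega q g ->
  is_state Omega delta p k u0 h g u -> affineX0 Omega delta p k u0 v ->
  energyR g v - energyR g u = bregman_gap u v.
Proof.
move=> Xu0 Lg [Au state] Av.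
have Xu := affineX0_X Xu0 Au; have Xv := affineX0_X Xu0 Av.
have X0vu := affineX0B Au Av; have Xvu := spaceXB Xv Xu.
have := state _ X0vu; rewrite formBhE// pairingE//; last exact: X_LpO.
rewrite pairingBr//; [|exact: X_LpO..]; move=> [E].
rewrite /bregman_gap (Rintegral_bregman p1 measurable_coef_weight coef_weight_ge0);
  [|exact: X_pfinite..].
rewrite -incrementB E -!/(form_power _) /energyR.
move: (form_power u) (form_power v) (pairing g u) (pairing g v) => a b c d; ring.
Qed.

Lemma state_minimizes u0 g u : X u0 -> Lp Omega q g ->
  is_state Omega delta p k u0 h g u ->
  is_minimum (affineX0 Omega delta p k u0) (energy Omega delta p k h g)
    (energyR g u)%:E.
Proof.
move=> Xu0 Lg su; have [Au _] := su; split.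
  by exists u; [exact: Au|exact: energyE Lg (affineX0_X Xu0 Au)].
move=> v Av; rewrite (energyE Lg (affineX0_X Xu0 Av)).
by rewrite lee_fin -subr_ge0 (energyR_state Xu0 Lg su Av) bregman_gap_ge0.
Qed.

Lemma pairing_weak_cvg (g_ : nat -> V -> R) g v :
  (forall j, Lp Omega q (g_ j)) -> Lp Omega q g -> weak_cvg_Lp Omega q g_ g ->
  Lp Omega p v -> pairing (g_ j) v @[j --> \oo] --> pairing g v.
Proof.
move=> Lg_ Lg wg Lv; have := wg v; rewrite conj_expK => /(_ Lv).
rewrite pairingE// => /fine_cvgP[_]; apply: cvg_trans; apply: near_eq_cvg.
by apply: nearW => j /=; rewrite pairingE.
Qed.

(** Weak convergence handles the fixed function [v], Hoelder's inequality and the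
    bound on the controls handle [u_ j - v]. *)
Lemma pairing_weak_strong (g_ u_ : nat -> V -> R) g v (K : R) :
  (forall j, Lp Omega q (g_ j)) -> (forall j, Lp_norm Omega q (g_ j) <= K) ->
  Lp Omega q g -> weak_cvg_Lp Omega q g_ g ->
  (forall j, Lp Omega p (u_ j)) -> Lp Omega p v -> strong_cvg_Lp Omega p u_ v ->
  pairing (g_ j) (u_ j) - pairing g (u_ j) @[j --> \oo] --> 0.
Proof.
move=> Lg_ gK Lg wg Lu_ Lv su.
have Luv j : Lp Omega p (u_ j \- v) by exact: LpB (ltW p1) (Lu_ j) Lv.
have c0 : Lp_norm Omega p (u_ j \- v) @[j --> \oo] --> 0 by exact: (fine_cvg su).
have bnd f j : Lp Omega q f -> `|pairing f (u_ j) - pairing f v| <=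
    Lp_norm Omega q f * Lp_norm Omega p (u_ j \- v).
  by move=> Lf; rewrite -pairingBr//; case: (pairing_bound Lf (Luv j)).
have cB : (pairing (g_ j) (u_ j) - pairing (g_ j) v) -
    (pairing g (u_ j) - pairing g v) @[j --> \oo] --> 0.
  apply/cvgr0Pnorm_le => e e0.
  have /cvgr0Pnorm_le/(_ e e0) : (K + Lp_norm Omega q g) *
      Lp_norm Omega p (u_ j \- v) @[j --> \oo] --> 0.
    rewrite -[X in _ --> X](mulr0 (K + Lp_norm Omega q g)).
    by apply: cvgM => //; exact: cvg_cst.
  apply: filterS => j; apply: le_trans; rewrite (le_trans (ler_normB _ _))//.
  rewrite (le_trans (lerD (bnd _ _ (Lg_ j)) (bnd _ _ Lg)))//.
  rewrite (le_trans _ (ler_norm _))// -mulrDl ler_wpM2r ?Lp_norm_ge0//.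
  by rewrite lerD2r.
have cw : pairing (g_ j) v - pairing g v @[j --> \oo] --> 0.
  rewrite -[X in _ --> X](subrr (pairing g v)).
  by apply: cvgB; [exact: pairing_weak_cvg|exact: cvg_cst].
rewrite -[X in _ --> X](addr0 0) (_ : (fun j => _) = fun j =>
    (pairing (g_ j) (u_ j) - pairing (g_ j) v - (pairing g (u_ j) - pairing g v)) +
    (pairing (g_ j) v - pairing g v)); first exact: cvgD cB cw.
by apply/funext => j; ring.
Qed.

(** Since [u_ j] minimizes the energy of [g_ j], comparing it with the competitor
    [u] bounds the gap by the pairing of [g_ j - g] with [u_ j - u], which tends
    to [0]. *)
Lemma energyR_cvg u0 (g_ u_ : nat -> V -> R) g u v (K : R) :
  X u0 -> (forall j, Lp Omega q (g_ j)) -> (forall j, Lp_norm Omega q (g_ j) <= K) ->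
  Lp Omega q g -> weak_cvg_Lp Omega q g_ g ->
  (forall j, is_state Omega delta p k u0 h (g_ j) (u_ j)) ->
  is_state Omega delta p k u0 h g u ->
  Lp Omega p v -> strong_cvg_Lp Omega p u_ v ->
  bregman_gap u (u_ j) @[j --> \oo] --> 0 /\
  energyR (g_ j) (u_ j) @[j --> \oo] --> energyR g u.
Proof.
move=> Xu0 Lg_ gK Lg wg su_ su Lv cu.
have Au : affineX0 Omega delta p k u0 u by case: su.
have Au_ j : affineX0 Omega delta p k u0 (u_ j) by case: (su_ j).
have Lu : Lp Omega p u by apply: X_LpO; exact: affineX0_X Au.
have Lu_ j : Lp Omega p (u_ j) by apply: X_LpO; exact: affineX0_X (Au_ j).
have cd := pairing_weak_strong Lg_ gK Lg wg Lu_ Lv cu.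
have cw := pairing_weak_cvg Lg_ Lg wg Lu.
have gapE j : bregman_gap u (u_ j) = energyR (g_ j) (u_ j) +
    (pairing (g_ j) (u_ j) - pairing g (u_ j)) - energyR g u.
  rewrite -(energyR_state Xu0 Lg su (Au_ j)) /energyR.
  move: (form_power u) (form_power (u_ j)) (pairing g u) => a b c.
  move: (pairing g (u_ j)) (pairing (g_ j) (u_ j)) => d d'; ring.
have cgap : bregman_gap u (u_ j) @[j --> \oo] --> 0.
  have : (pairing g u - pairing (g_ j) u) +
      (pairing (g_ j) (u_ j) - pairing g (u_ j)) @[j --> \oo] --> 0.
    rewrite -[X in _ --> X](addr0 0) -[X in _ --> X + _](subrr (pairing g u)).
    by apply: cvgD cd; apply: cvgB cw; exact: cvg_cst.
  move=> cr; apply: (squeeze_cvgr _ (cvg_cst 0) cr); apply: nearW => j.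
  rewrite bregman_gap_ge0/= gapE.
  have := bregman_gap_ge0 (u_ j) u.
  rewrite -(energyR_state Xu0 (Lg_ j) (su_ j) Au) /energyR.
  move: (form_power u) (form_power (u_ j)) (pairing g u) (pairing (g_ j) u) => a b c c'.
  move: (pairing g (u_ j)) (pairing (g_ j) (u_ j)) => d d'; lra.
split=> //.
rewrite -[X in _ --> X]add0r -[X in _ --> X]subr0 (_ : (fun j => _) = fun j =>
    bregman_gap u (u_ j) + energyR g u - (pairing (g_ j) (u_ j) - pairing g (u_ j))).
  by apply: cvgB cd; apply: cvgD cgap _; exact: cvg_cst.
by apply/funext => j; rewrite gapE; ring.
Qed.

Hypotheses (delta0 : 0 < delta) (bO : bounded_set Omega) (i0 : 'I_N)
  (k_pos : forall z : V, 0 < enorm z < delta -> 0 < k (enorm z)).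

Lemma coefficient_gt0 : {ae mu, forall x, Omega x -> 0 < h x}.
Proof.
case: hh => _ hO _; apply: filterS hO => x hO Ox.
by have /andP[hx _] := hO Ox; exact: lt_le_trans hx.
Qed.

(** The weight is positive at [(x, y)] as soon as [x] is in [Omega] and
    [0 < enorm (y - x) < delta], since then [h x > 0], [h y >= 0], and [y] is
    still in the enlarged domain. *)
Lemma increment_ae_eq u v : measurable_fun D u -> measurable_fun D v ->
  {ae mu, forall x, (D `\` Omega) x -> u x = v x} ->
  {ae nu, forall z, weight mean_coef z != 0 -> increment u z = increment v z} ->
  {ae mu, forall x, D x -> u x = v x}.
Proof.
move=> mu_ mv uv_out inc.
pose w x := (u \_ D) x - (v \_ D) x.
pose F z := weight mean_coef z * (increment u z - increment v z).
have mF : measurable_fun setT F.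
  apply: measurable_funM; first exact: measurable_coef_weight.
  by apply: measurable_funB; exact: measurable_increment.
have F0 : {ae nu, forall z, F z = 0}.
  apply: filterS inc => z iz; rewrite /F.
  by have [->|/iz ->] := eqVneq (weight mean_coef z) 0; rewrite ?mul0r// subrr mulr0.
have sec := ae_prod_section mF (P := fun x y => F (x, y) = 0) (fun _ _ => id) F0.
have w_loc : {ae mu, forall x, Omega x ->
    {ae mu, forall y, eball x delta y -> w y = w x}}.
  apply: filterS2 sec coefficient_gt0 => x secx hx Ox; have {}hx := hx Ox.
  apply: filterS2 secx coefficient_bounds => y Fxy hy Bxy.
  have [->//|yx] := eqVneq y x.
  have Dy : D y by exact: eball_sub_enlarge Bxy.
  have /andP[hy0 _] := hy Dy.
  have yx0 : 0 < enorm (y - x) by rewrite enorm_gt0// subr_eq0.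
  have Wxy : weight mean_coef (x, y) != 0.
    rewrite /weight patchE mem_set/=; last by split => //; exact: OD.
    rewrite !mulf_neq0 ?invr_eq0//.
    - by rewrite normr_eq0 /mean_coef gt_eqF// divr_gt0// ltr_wpDl.
    - by rewrite gt_eqF// k_pos// yx0.
    - by rewrite gt_eqF// powR_gt0.
  move/eqP: Fxy; rewrite /F mulf_eq0 (negPf Wxy)/= /increment /= => /eqP.
  by rewrite /w; lra.
have w_out : {ae mu, forall x, ~ Omega x -> w x = 0}.
  apply: filterS uv_out => x uvx Ox; rewrite /w !patchE.
  case: ifPn => [/set_mem Dx|_]; last by rewrite subrr.
  by rewrite uvx ?subrr.
apply: filterS (locally_constant_ae0 i0 delta0 bO w_loc w_out) => x wx Dx.
by move/eqP: wx; rewrite /w !patchE mem_set// subr_eq0 => /eqP.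
Qed.

(** Outside [Omega] all competitors agree with [u0], so the convergence almost
    everywhere in [Omega] extracted from the strong one passes to the
    increments. *)
Lemma state_limit_unique u0 (u_ : nat -> V -> R) u v :
  X u0 -> affineX0 Omega delta p k u0 u -> affineX0 Omega delta p k u0 v ->
  (forall j, affineX0 Omega delta p k u0 (u_ j)) ->
  strong_cvg_Lp Omega p u_ v -> bregman_gap u (u_ j) @[j --> \oo] --> 0 ->
  {ae mu, forall x, D x -> u x = v x}.
Proof.
move=> Xu0 Au Av Au_ cu cgap.
have Xu := affineX0_X Xu0 Au; have Xv := affineX0_X Xu0 Av.
have Xu_ j := affineX0_X Xu0 (Au_ j).
have mX f : X f -> measurable_fun D f by move=> [/(LpP _ mD p0)[]].
have out f f' : affineX0 Omega delta p k u0 f -> affineX0 Omega delta p k u0 f' ->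
    {ae mu, forall x, (D `\` Omega) x -> f x = f' x}.
  move=> Af Af'; have [_] := affineX0B Af' Af; apply: filterS => x ff' Dx.
  by apply/eqP; rewrite -subr_eq0; apply/eqP; exact: ff' Dx.
apply: increment_ae_eq; [exact: mX|exact: mX|exact: out|].
have [n_ n_cvg u_v] := Lp_cvg_subseq mO p1 (fun j => X_LpO (Xu_ j)) (X_LpO Xv) cu.
have u_vD : {ae mu, forall x, D x -> u_ (n_ i) x @[i --> \oo] --> v x}.
  have outn := ae_foralln (fun i => out _ _ (Au_ (n_ i)) Av).
  apply: filterS2 u_v outn => x u_vx outx Dx.
  have [Ox|nOx] := pselect (Omega x); first exact: u_vx.
  rewrite (_ : (fun i => _) = cst (v x)); first exact: cvg_cst.
  by apply/funext => i; exact: outx.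
apply: (Rintegral_bregman_cvg0 p1 measurable_coef_weight coef_weight_ge0
  (b_ := fun i => increment (u_ (n_ i)))).
- exact: (X_pfinite Xu).
- by move=> i; exact: (X_pfinite (Xu_ (n_ i))).
- apply: filterS (ae_prod u_vD) => z [c1 c2] Wz.
  have [D1 D2] : (D `*` D) z.
    apply: contrapT => Dz; move: Wz; rewrite /weight patchE memNset//.
    by rewrite eqxx.
  rewrite /increment !patchE !mem_set//.
  rewrite (_ : (fun i => _) = fun i => u_ (n_ i) z.2 - u_ (n_ i) z.1).
    by apply: cvgB; [exact: c2|exact: c1].
  by apply/funext => i; rewrite !patchE !mem_set.
- exact: (cvg_comp n_ _ n_cvg cgap).
Qed.

End coefficient_form.
End state_problem.

(** * Convergence of the minima and of the states *)

Theorem theorem2 (R : realType) (N : nat)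
    (Omega : set 'rV[R]_N) (delta p s : R)
    (Omega_neq0 : Omega !=set0) (Omega_open : open Omega)
    (Omega_connected : connected Omega) (Omega_bounded : bounded_set Omega)
    (delta_gt0 : 0 < delta) (p_gt1 : 1 < p) (s_gt0 : 0 < s) (s_lt1 : s < 1)
    (ps_ltN : p * s < N%:R)
    (k : R -> R) (c0 : R) (e : 'rV[R]_N) (e_unit : enorm e = 1)
    (c0_gt0 : 0 < c0)
    (k_measurable : measurable_fun [set: 'rV[R]_N] (fun z => k (enorm z)))
    (k_ge0 : forall z : 'rV[R]_N, 0 <= k (enorm z))
    (k_supp : closure [set z : 'rV[R]_N | k (enorm z) != 0]
       `<=` [set z | enorm z <= delta])
    (k_normalized : ((sphere_mean p e)^-1%:E *
       \int[lebesgueN N]_(z in eball 0%R delta) (k (enorm z))%:E = 1)%E)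
    (k_lower : forall z : 'rV[R]_N, 0 < enorm z < delta ->
       c0 / enorm z `^ (N%:R + (s - 1) * p) <= k (enorm z))
    (hmin hmax : R) (hmin_gt0 : 0 < hmin) (hmin_lt_hmax : hmin < hmax)
    (h h0 : 'rV[R]_N -> R)
    (h_coef : coefficient Omega delta hmin hmax h)
    (h0_coef : coefficient Omega delta hmin hmax h0)
    (u0 : 'rV[R]_N -> R) (u0_X : spaceX Omega delta p k u0)
    (beta gamma : R) (beta_gt0 : 0 < beta) (gamma_gt0 : 0 < gamma)
    (G : 'rV[R]_N -> R -> R)
    (G_measurable : measurable_fun (Omega `*` [set: R]) (fun y => G y.1 y.2))
    (G_ge0 : forall x a, Omega x -> 0 <= G x a)
    (L : R) (L_gt0 : 0 < L)
    (G_lipschitz : forall x a b, Omega x -> `|G x a - G x b| <= L * `|a - b|)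
    (g_ u_ : nat -> 'rV[R]_N -> R) (g ustar u : 'rV[R]_N -> R) (C : R)
    (gu_admissible : forall j,
       admissible_pairs Omega delta p k u0 h (g_ j, u_ j))
    (gu_minimizing :
       cost Omega delta p k G beta gamma h0 (g_ j, u_ j) @[j --> \oo] -->
       ereal_inf [set cost Omega delta p k G beta gamma h0 gu
                 | gu in admissible_pairs Omega delta p k u0 h])
    (C_gt0 : 0 < C)
    (g_bounded : forall j, (\int[lebesgueN N]_(x in Omega)
       (`|g_ j x| `^ (p / (p - 1)))%R%:E < C%:E)%E)
    (g_Lp' : Lp Omega (p / (p - 1)) g)
    (g_weak : weak_cvg_Lp Omega (p / (p - 1)) g_ g)
    (u_strong : strong_cvg_Lp Omega p u_ ustar)
    (ustar_affine : affineX0 Omega delta p k u0 ustar)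
    (u_state : is_state Omega delta p k u0 h g u) :
  (exists (m_ : nat -> R) (m : R),
     [/\ forall j, is_minimum (affineX0 Omega delta p k u0)
           (energy Omega delta p k h (g_ j)) (m_ j)%:E,
         is_minimum (affineX0 Omega delta p k u0)
           (energy Omega delta p k h g) m%:E &
         m_ j @[j --> \oo] --> m]) /\
  {ae lebesgueN N, forall x, enlarge Omega delta x -> u x = ustar x}.
Proof.
have hmax_gt0 : 0 < hmax by exact: lt_trans hmin_lt_hmax.
have q_gt0 : 0 < p / (p - 1) by exact: lt_trans (conj_exp_gt1 p_gt1).
have Lg_ j : Lp Omega (p / (p - 1)) (g_ j) by case: (gu_admissible j).
have state_ j : is_state Omega delta p k u0 h (g_ j) (u_ j) by case: (gu_admissible j).
have affine_ j : affineX0 Omega delta p k u0 (u_ j) by case: (state_ j).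
have affine : affineX0 Omega delta p k u0 u by case: u_state.
have ustar_Lp : Lp Omega p ustar.
  exact: (X_LpO Omega_open p_gt1 k_measurable k_ge0
    (affineX0_X Omega_open p_gt1 k_measurable k_ge0 u0_X ustar_affine)).
have g_norm j : Lp_norm Omega (p / (p - 1)) (g_ j) <= C `^ (p / (p - 1))^-1.
  by apply: Lp_norm_le => //; exact: open_measurable_rV.
have [gap_cvg0 energy_cvg] := energyR_cvg Omega_open p_gt1 k_measurable k_ge0
  hmin_gt0 hmax_gt0 h_coef u0_X Lg_ g_norm g_Lp' g_weak state_ u_state
  ustar_Lp u_strong.
split.
  exists (fun j => energyR Omega delta p k h (g_ j) (u_ j)),
    (energyR Omega delta p k h g u).
  split; last exact: energy_cvg.
    move=> j; exact: (state_minimizes Omega_open p_gt1 k_measurable k_ge0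
      hmin_gt0 hmax_gt0 h_coef u0_X (Lg_ j) (state_ j)).
  exact: (state_minimizes Omega_open p_gt1 k_measurable k_ge0 hmin_gt0 hmax_gt0
    h_coef u0_X g_Lp' u_state).
have e_neq0 : enorm e != 0 by rewrite e_unit oner_neq0.
pose i0 := Ordinal (enorm_neq0_dim e_neq0).
have k_pos (z : 'rV[R]_N) : 0 < enorm z < delta -> 0 < k (enorm z).
  move=> /[dup] /andP[z0 _] /k_lower; apply: lt_le_trans.
  by rewrite divr_gt0// powR_gt0.
exact: (state_limit_unique Omega_open p_gt1 k_measurable k_ge0 hmin_gt0 hmax_gt0
  h_coef delta_gt0 Omega_bounded i0 k_pos u0_X affine ustar_affine affine_ u_strong).
Qed.
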